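(* Let $\mathcal K=\langle\mathcal F,\delta\rangle$ be a differentially closed field of characteristic zero, where $\mathcal F=\langle F,+,\cdot\rangle$ is the underlying algebraically closed field, and let $C=\ker(\delta)$ be its field of constants. Let $X\subseteq F^n$ be a set definable in the pair $\mathcal M=\langle\mathcal F,C\rangle$. Then $\dim_2(X)=\delta\text{-}\dim(X)$.
   Context: Definability is with parameters. $\dim_2$: let $\mathcal M^*=\langle\mathcal F^*,C^*\rangle$ be an $|F|^+$-saturated elementary extension of $\mathcal M$; for $A\subseteq F^*$ let $\operatorname{cl}_F(A)=\operatorname{acl}(A\cup F\cup C^* )$, the field-theoretic algebraic closure in $F^*$; this is a pregeometry, and for nonempty $X$ definable in $\mathcal M$, $\dim_2(X)=\max_{a\in X(F^* )}\operatorname{cl}_F\text{-}\dim(a)$ (size of a maximal independent subtuple), with $\dim_2(\emptyset)=-\infty$. $\delta$-dimension: for an $|F|^+$-saturated elementary extension $\mathcal K^*=\langle\mathcal F^*,\delta\rangle$ of $\mathcal K$ and nonempty $X$ definable in $\mathcal K$, $\delta\text{-}\dim(X)$ is the maximum over $a\in X(F^* )$ of the differential transcendence degree of $a$ over $F$, with $\delta\text{-}\dim(\emptyset)=-\infty$. *)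

(* Defs.v *)
From HB Require Import structures.
From mathcomp Require Import all_boot all_order all_algebra.
From mathcomp Require Import mpoly.
Set Implicit Arguments. Unset Strict Implicit. Unset Printing Implicit Defensive.
Import GRing.Theory.
Local Open Scope ring_scope.

(* First-order syntax for the language of rings, augmented with a unary *)
(* function symbol D (the derivation, language of K) and a unary        *)
(* predicate CP (the constants, language of the pair M).  Parameters of *)
(* type P may occur in terms (definability with parameters).           *)
Inductive term (P : Type) : Type :=
  | TVar of nat | TPar of P | TZero | TOne
  | TAdd of term P & term P | TOpp of term P | TMul of term P & term P
  | TDer of term P.

Inductive fml (P : Type) : Type :=
  | FEq of term P & term P
  | FC of term P
  | FNot of fml P
  | FAnd of fml P & fml P
  | FEx of nat & fml P.

Arguments TZero {P}. Arguments TOne {P}.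

Fixpoint noDer P (t : term P) : Prop :=
  match t with
  | TAdd t u | TMul t u => noDer t /\ noDer u
  | TOpp t => noDer t
  | TDer _ => False
  | _ => True
  end.

Fixpoint pair_fml P (f : fml P) : Prop :=
  match f with
  | FEq t u => noDer t /\ noDer u
  | FC t => noDer t
  | FNot f => pair_fml f
  | FAnd f g => pair_fml f /\ pair_fml g
  | FEx _ f => pair_fml f
  end.

Fixpoint diff_fml P (f : fml P) : Prop :=
  match f with
  | FEq _ _ => True
  | FC _ => False
  | FNot f => diff_fml f
  | FAnd f g => diff_fml f /\ diff_fml g
  | FEx _ f => diff_fml f
  end.

Fixpoint to_diff P (f : fml P) : fml P :=
  match f with
  | FEq t u => FEq t u
  | FC t => FEq (TDer t) TZero
  | FNot f => FNot (to_diff f)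
  | FAnd f g => FAnd (to_diff f) (to_diff g)
  | FEx i f => FEx i (to_diff f)
  end.

Fixpoint term_pars P (t : term P) : seq P :=
  match t with
  | TPar p => [:: p]
  | TAdd t u | TMul t u => term_pars t ++ term_pars u
  | TOpp t | TDer t => term_pars t
  | _ => [::]
  end.

Fixpoint fml_pars P (f : fml P) : seq P :=
  match f with
  | FEq t u => term_pars t ++ term_pars u
  | FC t => term_pars t
  | FNot f => fml_pars f
  | FAnd f g => fml_pars f ++ fml_pars g
  | FEx _ f => fml_pars f
  end.

Fixpoint Allp (T : Type) (Q : T -> Prop) (l : seq T) : Prop :=
  if l is x :: l' then Q x /\ Allp Q l' else True.

Section Semantics.
Variables (R : fieldType) (d : R -> R) (c : R -> Prop) (P : Type) (par : P -> R).

Fixpoint teval (v : nat -> R) (t : term P) : R :=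
  match t with
  | TVar i => v i
  | TPar p => par p
  | TZero => 0
  | TOne => 1
  | TAdd t u => teval v t + teval v u
  | TOpp t => - teval v t
  | TMul t u => teval v t * teval v u
  | TDer t => d (teval v t)
  end.

Definition upd (v : nat -> R) (i : nat) (x : R) : nat -> R :=
  fun j => if j == i then x else v j.

Fixpoint sat (v : nat -> R) (f : fml P) : Prop :=
  match f with
  | FEq t u => teval v t = teval v u
  | FC t => c (teval v t)
  | FNot f => ~ sat v f
  | FAnd f g => sat v f /\ sat v g
  | FEx i f => exists x, sat (upd v i x) f
  end.

End Semantics.

(* valuation given by an n-tuple (variables >= n are sent to 0) *)
Definition tval (R : fieldType) n (a : 'I_n -> R) : nat -> R :=
  fun k => if insub k is Some i then a i else 0.

Definition defset (R : fieldType) (d : R -> R) (c : R -> Prop) P (par : P -> R)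
  n (f : fml P) (a : 'I_n -> R) : Prop := sat d c par (tval a) f.

(* Elementary extensions and saturation, for a language L (a class of   *)
(* formulas).  The extension is given by a map e : R -> R' (identifying *)
(* R with a subset of R').                                              *)
Definition elem_ext (L : forall P, fml P -> Prop)
  (R : fieldType) (d : R -> R) (c : R -> Prop)
  (R' : fieldType) (d' : R' -> R') (c' : R' -> Prop) (e : R -> R') : Prop :=
  forall (f : fml R) (v : nat -> R), L R f ->
    (sat d c id v f <-> sat d' c' e (fun k => e (v k)) f).

(* |R|^+-saturation of R': every set of formulas in one variable (all   *)
(* variables are interpreted by the same element x) with parameters in  *)
(* a set A of cardinality <= |R| which is finitely satisfiable in R' is *)
(* realized in R'.                                                      *)
Definition saturated_over (L : forall P, fml P -> Prop) (R : Type)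
  (R' : fieldType) (d' : R' -> R') (c' : R' -> Prop) : Prop :=
  forall (Sigma : fml R' -> Prop) (A : R' -> Prop) (g : R' -> R),
    (forall x y, A x -> A y -> g x = g y -> x = y) ->
    (forall f, Sigma f -> L R' f /\ Allp A (fml_pars f)) ->
    (forall l : seq (fml R'), Allp Sigma l ->
       exists x, Allp (sat d' c' id (fun _ => x)) l) ->
    exists x, forall f, Sigma f -> sat d' c' id (fun _ => x) f.

Definition derivation (R : fieldType) (d : R -> R) : Prop :=
  (forall x y, d (x + y) = d x + d y) /\ (forall x y, d (x * y) = d x * y + x * d y).

(* Blum's axioms: for differential polynomials f of order k (f depends   *)
(* on x^(k)) and g <> 0 of order < k, there is a with f(a)=0, g(a)<>0.   *)
Definition diff_closed (R : fieldType) (d : R -> R) : Prop :=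
  forall (k : nat) (f : {mpoly R[k.+1]}) (g : {mpoly R[k]}),
    (exists2 m, m \in msupp f & (0 < m ord_max)%N) -> g != 0 ->
    exists a : R, f.@[fun i => iter i d a] = 0 /\ g.@[fun i => iter i d a] != 0.

Inductive gen_field (R : fieldType) (A : R -> Prop) : R -> Prop :=
  | gf_base x : A x -> gen_field A x
  | gf_0 : gen_field A 0
  | gf_1 : gen_field A 1
  | gf_add x y : gen_field A x -> gen_field A y -> gen_field A (x + y)
  | gf_opp x : gen_field A x -> gen_field A (- x)
  | gf_mul x y : gen_field A x -> gen_field A y -> gen_field A (x * y)
  | gf_inv x : gen_field A x -> gen_field A x^-1.

Definition algebraic_over (R : fieldType) (A : R -> Prop) (x : R) : Prop :=
  exists p : {poly R}, p != 0 /\ (forall i, gen_field A p`_i) /\ root p x.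

(* cl_F(A) = acl(A u F u C1) in the saturated pair <F1, C1> *)
Definition cl2 (R : fieldType) (R' : fieldType) (e : R -> R') (c' : R' -> Prop)
  (A : R' -> Prop) (x : R') : Prop :=
  algebraic_over (fun y => A y \/ (exists z, y = e z) \/ c' y) x.

(* x is differentially algebraic over the differential field F<A>       *)
Definition dcl (R : fieldType) (R' : fieldType) (e : R -> R') (d' : R' -> R')
  (A : R' -> Prop) (x : R') : Prop :=
  exists k, algebraic_over
    (fun y => (exists w j, (A w \/ exists z, w = e z) /\ y = iter j d' w)
              \/ (exists j, (j < k)%N /\ y = iter j d' x))
    (iter k d' x).

Definition indep (R' : Type) (cl : (R' -> Prop) -> R' -> Prop) n (a : 'I_n -> R')
  (S : {set 'I_n}) : Prop :=
  forall i, i \in S -> ~ cl (fun y => exists2 j, j \in S & j != i /\ y = a j) (a i).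

Definition cl_dim (R' : Type) (cl : (R' -> Prop) -> R' -> Prop) n (a : 'I_n -> R')
  (k : nat) : Prop :=
  exists S, [/\ indep cl a S, #|S| = k & forall S', indep cl a S' -> (#|S'| <= k)%N].

(* dimension of X (given as its set of realizations in the saturated     *)
(* model): None stands for -oo (X empty), Some k for the maximum of rk.  *)
Definition is_dim (R' : Type) n (X : ('I_n -> R') -> Prop)
  (rk : ('I_n -> R') -> nat -> Prop) (D : option nat) : Prop :=
  match D with
  | None => forall a, ~ X a
  | Some k => (exists a, X a /\ rk a k) /\ (forall a k', X a -> rk a k' -> (k' <= k)%N)
  end.

Arguments indep {R'} cl {n} a S.
Arguments cl_dim {R'} cl {n} a k.
Arguments defset {R} d c {P} par {n} f a.
Arguments is_dim {R' n} X rk D.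

(* Main.v *)
Require Import Defs.
From HB Require Import structures.
From mathcomp Require Import all_boot all_order all_algebra.
From mathcomp Require Import mpoly.
From mathcomp Require Import ring zify.
From Stdlib Require Import Classical ClassicalEpsilon FunctionalExtensionality.
Set Implicit Arguments. Unset Strict Implicit. Unset Printing Implicit Defensive.
Import GRing.Theory.
Local Open Scope ring_scope.

(** A tuple of [F2] whose coordinates [S] are differentially independent over [F]
    is algebraically independent over [F] and the constants of [F2]: if [x] is
    algebraic over [L(c_1, ..., c_r)] with [L] a differential field and the [c_i]
    constant, then so are all its derivatives, and [r + 1] of them are dependent
    over [L]. Conversely, a tuple algebraically independent over [F] and the
    constants has only one type over [F] in the language of pairs. This follows
    from a back-and-forth between [<F1, C1>] and [<F2, ker delta2>] (the latter is
    also a saturated elementary extension of the pair): the partial isomorphisms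
    are given by finitely generated extensions [K] of [F] embedded in both fields
    freely from the constants. Hence a point of [X] in one structure whose
    coordinates [S] are independent yields a point of [X] in the other one whose
    coordinates [S] are any prescribed independent tuple; such tuples exist by
    saturation and Blum's axioms. *)

(** * Algebraic closure as a pregeometry *)

(** The field [F1] carries no derivation, so every fact needed there must arrive as a sentence true
    in [F]. This concerns above all the elements lying outside the algebraic closure of [F], a
    finite tuple and [C1]: each finite part of that type is realized in [F2] by one differentially
    transcendental element, descends to [F] because [<F, ker delta>] is elementary in
    [<F2, ker delta2>], and ascends to [F1], where saturation assembles the parts. The delicate
    atomic formula of the back-and-forth is [FC]: which elements of [K] are constants must be
    decided by a finite list of constants. The reason is that [F] and the constants are linearly
    disjoint over [ker delta], a property that passes to elementary extensions one length at a time;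
    an algebraic relation of a constant over [F] then splits into relations over [ker delta]. Since
    pairs do not see [delta2], the tuple of [F2] onto which a point of [X] is moved is made
    differentially independent beforehand. Both dimensions are the largest [#|S|] such that some
    point of [X] is independent on [S], so it suffices that the same sets [S] occur on both
    sides. *)

Definition asb (P : Prop) : bool :=
  if excluded_middle_informative P then true else false.

Lemma asbP (P : Prop) : reflect P (asb P).
Proof. by rewrite /asb; case: excluded_middle_informative => h; constructor. Qed.

Section SubfieldType.
Variables (G : fieldType) (A : G -> Prop).

Definition gen_pred : {pred G} := fun x => asb (gen_field A x).

Lemma gen_predP x : reflect (gen_field A x) (x \in gen_pred).
Proof. exact: asbP. Qed.

Lemma gen_pred_divring_closed : divring_closed gen_pred.
Proof.
split.
- by apply/gen_predP; apply: gf_1.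
- move=> x y /gen_predP hx /gen_predP hy; apply/gen_predP.
  by apply: gf_add => //; apply: gf_opp.
- move=> x y /gen_predP hx /gen_predP hy; apply/gen_predP.
  by apply: gf_mul => //; apply: gf_inv.
Qed.

HB.instance Definition _ := GRing.isDivringClosed.Build G gen_pred gen_pred_divring_closed.

Record gen_type := GenType { gen_val :> G; gen_valP : gen_val \in gen_pred }.
HB.instance Definition _ := [isSub for gen_val].
HB.instance Definition _ := [Choice of gen_type by <:].
HB.instance Definition _ := [SubChoice_isSubIntegralDomain of gen_type by <:].
HB.instance Definition _ := [SubIntegralDomain_isSubField of gen_type by <:].

(* [val] is hidden behind an opaque constant so that simplification does not
   unfold its morphism structure. *)
Fact gen_inj_sig : {i : {rmorphism gen_type -> G} | forall x, i x = val x}.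
Proof. by exists (\val : {rmorphism gen_type -> G}). Qed.

Definition gen_inj : {rmorphism gen_type -> G} := sval gen_inj_sig.

Lemma gen_injE x : gen_inj x = val x.
Proof. exact: (svalP gen_inj_sig). Qed.

Lemma gen_typeP (x : gen_type) : gen_field A (gen_inj x).
Proof. by rewrite gen_injE; apply/gen_predP; exact: gen_valP. Qed.

Lemma gen_lift x : gen_field A x -> exists y : gen_type, gen_inj y = x.
Proof. by move=> /gen_predP hx; exists (GenType hx); rewrite gen_injE. Qed.

End SubfieldType.

Notation acl := algebraic_over.

Section AlgebraicClosure.
Variable G : fieldType.
Implicit Types (A B C R : G -> Prop) (x y z : G) (p q : {poly G}).

Lemma gen_bind A B x :
  (forall y, A y -> gen_field B y) -> gen_field A x -> gen_field B x.
Proof.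
move=> h; elim=> {x} [x /h //| | |x y _ hx _ hy|x _ hx|x y _ hx _ hy|x _ hx].
- exact: gf_0.
- exact: gf_1.
- exact: gf_add.
- exact: gf_opp.
- exact: gf_mul.
- exact: gf_inv.
Qed.

Lemma gen_mono A B x : (forall y, A y -> B y) -> gen_field A x -> gen_field B x.
Proof. by move=> h; apply: gen_bind => y /h; apply: gf_base. Qed.

Lemma gen_poly_lift A p : (forall i, gen_field A p`_i) ->
  exists q : {poly gen_type A}, map_poly (gen_inj A) q = p.
Proof.
move=> h; exists (\poly_(i < size p) insubd (0 : gen_type A) p`_i).
apply/polyP => i; rewrite coef_map /= coef_poly; case: ltnP => hi.
  by rewrite gen_injE insubdK //; apply/gen_predP.
by rewrite rmorph0 nth_default.
Qed.

(** Gives access to the stability of [algebraicOver] under the field operations. *)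
Lemma aclE A x : acl A x <-> algebraicOver (gen_inj A) x.
Proof.
split=> [[p [p0 [hp px]]]|[q q0 qx]].
  have [q qE] := gen_poly_lift hp; exists q; last by rewrite qE.
  by apply: contra_neq p0 => q0; rewrite -qE q0 rmorph0.
exists (map_poly (gen_inj A) q); split; first by rewrite map_poly_eq0.
by split=> // i; rewrite coef_map; apply: gen_typeP.
Qed.

Lemma acl_gen A x : gen_field A x -> acl A x.
Proof. by move=> /gen_lift [y <-]; apply/aclE; apply: algebraic_id. Qed.

Lemma acl_base A x : A x -> acl A x.
Proof. by move=> h; apply/acl_gen/gf_base. Qed.

Lemma acl_field A x : gen_field (acl A) x -> acl A x.
Proof.
elim=> {x} [x //| | |x y _ hx _ hy|x _ hx|x y _ hx _ hy|x _ hx].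
- exact/acl_gen/gf_0.
- exact/acl_gen/gf_1.
- by apply/aclE/algebraic_add; apply/aclE.
- by apply/aclE/algebraic_opp; apply/aclE.
- by apply/aclE/algebraic_mul; apply/aclE.
- by apply/aclE/algebraic_inv; apply/aclE.
Qed.

Lemma acl_trans A B x : (forall y, A y -> acl B y) -> acl A x -> acl B x.
Proof.
move=> h [p [p0 [hp px]]]; apply/aclE/integral_algebraic.
apply: (integral_root p0 px) => _ /(nthP 0) [i _ <-].
apply/integral_algebraic/aclE/acl_field.
by apply: gen_mono (hp i).
Qed.

Lemma acl_mono A B x : (forall y, A y -> B y) -> acl A x -> acl B x.
Proof. by move=> h; apply: acl_trans => y /h /acl_base. Qed.

Lemma gen_finite A B x : gen_field (fun y => A y \/ B y) x ->
  exists l : seq G, (forall y, y \in l -> B y) /\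
    gen_field (fun y => A y \/ y \in l) x.
Proof.
have two y z (op : G -> G -> G) :
    (forall D y z, gen_field D y -> gen_field D z -> gen_field D (op y z)) ->
    (exists l : seq G, (forall y, y \in l -> B y) /\
       gen_field (fun y => A y \/ y \in l) y) ->
    (exists l : seq G, (forall y, y \in l -> B y) /\
       gen_field (fun y => A y \/ y \in l) z) ->
    exists l : seq G, (forall y, y \in l -> B y) /\
       gen_field (fun y => A y \/ y \in l) (op y z).
  move=> hop [l1 [h1 g1]] [l2 [h2 g2]]; exists (l1 ++ l2); split.
    by move=> u; rewrite mem_cat => /orP [/h1|/h2].
  apply: hop.
    by apply: gen_mono g1 => u [|h]; [left|right; rewrite mem_cat h].
  by apply: gen_mono g2 => u [|h]; [left|right; rewrite mem_cat h orbT].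
elim=> {x} [x [h|h]| | |x y _ hx _ hy|x _ [l [h g]]|x y _ hx _ hy|x _ [l [h g]]].
- by exists [::]; split=> //; apply: gf_base; left.
- exists [:: x]; split; first by move=> y; rewrite inE => /eqP ->.
  by apply: gf_base; right; rewrite inE.
- by exists [::]; split=> //; apply: gf_0.
- by exists [::]; split=> //; apply: gf_1.
- by apply: two => //; apply: gf_add.
- by exists l; split=> //; apply: gf_opp.
- by apply: two => //; apply: gf_mul.
- by exists l; split=> //; apply: gf_inv.
Qed.

Lemma acl_finite A B x : acl (fun y => A y \/ B y) x ->
  exists l : seq G, (forall y, y \in l -> B y) /\ acl (fun y => A y \/ y \in l) x.
Proof.
case=> p [p0 [hp px]].
have [l [hl hp']] : exists l : seq G, (forall y, y \in l -> B y) /\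
    forall i, (i < size p)%N -> gen_field (fun y => A y \/ y \in l) p`_i.
  elim: (size p) => [|n [l [hl IH]]]; first by exists [::].
  have [l' [hl' g']] := gen_finite (hp n).
  exists (l ++ l'); split.
    by move=> u; rewrite mem_cat => /orP [/hl|/hl'].
  move=> i; rewrite ltnS leq_eqVlt => /orP [/eqP ->|hi].
    by apply: gen_mono g' => u [|h]; [left|right; rewrite mem_cat h orbT].
  by apply: gen_mono (IH i hi) => u [|h]; [left|right; rewrite mem_cat h].
exists l; split=> //; exists p; split=> //; split=> // i.
case: (ltnP i (size p)) => [/hp' //|h]; rewrite nth_default //; exact: gf_0.
Qed.

Definition subring_pred R : Prop :=
  [/\ R 0, R 1, forall x y, R x -> R y -> R (x + y), forall x, R x -> R (- x)
    & forall x y, R x -> R y -> R (x * y)].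

(** Fractions over a subring containing [A] are stable under the field operations. Taking for [R]
    the values of polynomials or of derivative-free terms turns membership in a generated field into
    syntax. *)
Lemma gen_fraction A R x : subring_pred R -> (forall y, A y -> R y) ->
  gen_field A x -> exists u w, [/\ R u, R w, w != 0 & x * w = u].
Proof.
case=> R0 R1 RD RN RM AR.
elim=> {x} [x /AR h| | |x y _ [u [w [hu hw w0 e]]] _ [u' [w' [hu' hw' w0' e']]]
  |x _ [u [w [hu hw w0 e]]]
  |x y _ [u [w [hu hw w0 e]]] _ [u' [w' [hu' hw' w0' e']]]|x _ [u [w [hu hw w0 e]]]].
- by exists x, 1; rewrite oner_neq0 mulr1.
- by exists 0, 1; rewrite oner_neq0 mul0r.
- by exists 1, 1; rewrite oner_neq0 mulr1.
- exists (u * w' + u' * w), (w * w'); split; auto; first by rewrite mulf_neq0.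
  by rewrite -e -e'; ring.
- by exists (- u), w; split; auto; rewrite mulNr e.
- exists (u * u'), (w * w'); split; auto; first by rewrite mulf_neq0.
  by rewrite -e -e'; ring.
- have [x0|x0] := eqVneq x 0.
    by exists 0, 1; rewrite x0 invr0 mul0r oner_neq0.
  exists w, u; split=> //; first by rewrite -e mulf_neq0.
  by rewrite -e mulKf.
Qed.

Lemma clear_denominators A R p : subring_pred R -> (forall y, A y -> R y) ->
  (forall i, gen_field A p`_i) ->
  exists w, [/\ R w, w != 0 & forall i, R (w * p`_i)].
Proof.
move=> hR AR; case: (hR) => R0 R1 RD RN RM.
elim/poly_ind: p => [|p c IH] h.
  by exists 1; split=> [||i] //; rewrite ?oner_neq0 // coef0 mulr0.
have [i|w [hw w0 hp]] := IH.
  by move: (h i.+1); rewrite coefD coefMX coefC addr0.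
have [u [w' [hu hw' w0' e]]] : exists u w', [/\ R u, R w', w' != 0 & c * w' = u].
  apply: (gen_fraction hR AR); move: (h 0%N).
  by rewrite coefD coefMX coefC add0r.
exists (w * w'); split=> [||i]; auto; first by rewrite mulf_neq0.
rewrite coefD coefMX coefC; case: i => [|i] /=.
  rewrite add0r; have -> : w * w' * c = w * u by rewrite -e; ring.
  exact: RM.
by rewrite addr0 mulrAC; auto.
Qed.

Lemma acl_exchange A x y : acl (fun z => A z \/ z = x) y -> ~ acl A y ->
  acl (fun z => A z \/ z = y) x.
Proof.
move=> [p [p0 [hp py]]] hy.
pose K := gen_type A.
pose R z := exists q : {poly K}, z = (map_poly (gen_inj A) q).[x].
have hR : subring_pred R.
  split.
  - by exists 0; rewrite rmorph0 horner0.
  - by exists 1; rewrite rmorph1 hornerE.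
  - by move=> _ _ [q ->] [r ->]; exists (q + r); rewrite rmorphD hornerD.
  - by move=> _ [q ->]; exists (- q); rewrite rmorphN hornerN.
  - by move=> _ _ [q ->] [r ->]; exists (q * r); rewrite rmorphM hornerM.
have AR z : A z \/ z = x -> R z.
  case=> [/gf_base/gen_lift [u <-]|->].
    by exists u%:P; rewrite map_polyC hornerC.
  by exists 'X; rewrite map_polyX hornerX.
have [w [_ w0 /choice [r rE]]] := clear_denominators hR AR hp.
(* [P] has two variables: the outer one stands for [y], the inner one for [x]. Putting [y] for the
   outer variable leaves a polynomial with coefficients in the field generated by [A] and [y], and
   it vanishes at [x]. *)
pose P := \poly_(i < size p) r i.
pose PG := map_poly (map_poly (gen_inj A)) P.
have PGx : map_poly (horner_eval x) PG = w *: p.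
  apply/polyP => i; rewrite coef_map /= coef_map /= coefZ coef_poly /horner_eval.
  case: ltnP => hi; first by rewrite rE.
  by rewrite rmorph0 horner0 nth_default // mulr0.
have PGyx : PG.[y%:P].[x] = 0.
  rewrite -horner2_swapXY horner_swapXY PGx hornerZ (rootP py); exact: mulr0.
exists PG.[y%:P]; split; last split; last by rewrite rootE PGyx.
  (* If that polynomial were zero, each coefficient of [swapXY P], a polynomial over the field
     generated by [A], would vanish at [y]. As [y] is not algebraic over [A], all of them would be
     zero, hence [P] and [p] too. *)
  apply/eqP => PGy; have P0 : P = 0.
    apply/eqP; rewrite -swapXY_eq0; apply/eqP/polyP => j; rewrite coef0.
    apply/eqP; apply/negbNE/negP => Pj; apply: hy; apply/aclE.
    exists (swapXY P)`_j => //; rewrite rootE.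
    have := congr1 (fun q : {poly G} => q`_j) PGy.
    rewrite horner_polyC coef_map coef0 /= swapXY_map coef_map /= /horner_eval.
    by move=> ->.
  move: PGx; rewrite /PG P0 !rmorph0 => /esym/eqP.
  by rewrite scaler_eq0 (negbTE w0) (negbTE p0).
move=> j; rewrite horner_polyC coef_map /= /horner_eval swapXY_map coef_map /=.
rewrite horner_coef.
elim/big_ind: _ => [|a b ha hb|i _]; [exact: gf_0|exact: gf_add|].
apply: gf_mul.
  by rewrite coef_map; apply: gen_mono (gen_typeP _); left.
elim: (i : nat) => [|k IH]; first by rewrite expr0; apply: gf_1.
by rewrite exprS; apply: gf_mul => //; apply: gf_base; right.
Qed.

Fixpoint seq_indep A (b : seq G) : Prop :=
  if b is y :: b' then ~ acl A y /\ seq_indep (fun z => A z \/ z = y) b' else True.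

Lemma seq_indep_ext A B b : (forall z, A z <-> B z) -> seq_indep A b -> seq_indep B b.
Proof.
elim: b A B => //= y b IH A B h [hy hb]; split.
  by move=> k; apply: hy; apply: acl_mono k => z /h.
by apply: IH hb => z; split=> -[/h|]; auto.
Qed.

(** Adjoin the elements of [t] to [A] one at a time, and let [x] be the first that makes [y]
    algebraic. By exchange [y] can replace [x], and the induction continues with [y] added to [A]
    and [x] removed from [t]. *)
Lemma steinitz A (b t : seq G) : seq_indep A b ->
  (forall y, y \in b -> acl (fun z => A z \/ z \in t) y) -> (size b <= size t)%N.
Proof.
elim: b A t => // y b IH A t /= [hy hb] h.
have [t1 [x [t2 [tE hy1 hy2]]]] : exists t1 x t2, [/\ t = t1 ++ x :: t2,
    ~ acl (fun z => A z \/ z \in t1) y & acl (fun z => (A z \/ z \in t1) \/ z = x) y].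
  have := h y (mem_head _ _).
  have : forall t1, ~ acl (fun z => A z \/ z \in t1) y ->
      acl (fun z => A z \/ z \in t1 ++ t) y ->
      exists t1' x t2, [/\ t1 ++ t = t1' ++ x :: t2,
      ~ acl (fun z => A z \/ z \in t1') y & acl (fun z => (A z \/ z \in t1') \/ z = x) y].
    elim: t {h} => [|x t IHt] t1 h1; first by rewrite cats0.
    rewrite -cat_rcons => h2.
    have [h3|h3] := classic (acl (fun z => A z \/ z \in rcons t1 x) y).
      exists t1, x, t; split=> //; first by rewrite cat_rcons.
      apply: acl_mono h3 => z; rewrite mem_rcons inE => -[|/orP[/eqP|]]; auto.
    by case: (IHt _ h3 h2) => t1' [x' [t2 H]]; exists t1', x', t2.
  by move=> /(_ [::]) /= H hyt; apply: H hyt => k; apply: hy; apply: acl_mono k => z [].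
rewrite {t}tE in h *; rewrite size_cat /= addnS ltnS -size_cat.
have hx := acl_exchange hy2 hy1.
apply: (IH _ _ hb) => u hu.
have hu' : u \in y :: b by rewrite inE hu orbT.
apply: acl_trans (h u hu') => z [hz|]; first by apply: acl_base; auto.
rewrite mem_cat inE => /or3P [hz|/eqP ->|hz].
- by apply: acl_base; right; rewrite mem_cat hz.
- by apply: acl_mono hx => v [[|hv]|]; auto; right; rewrite mem_cat hv.
- by apply: acl_base; right; rewrite mem_cat hz orbT.
Qed.

Lemma seq_indep_iota A (f : nat -> G) n :
  (forall k, (k < n)%N -> ~ acl (fun z => A z \/ exists j, (j < k)%N /\ z = f j) (f k)) ->
  seq_indep A (map f (iota 0 n)).
Proof.
move=> h.
suff H m k : (m + k = n)%N ->
  seq_indep (fun z => A z \/ exists j, (j < m)%N /\ z = f j) (map f (iota m k)).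
  by apply: seq_indep_ext (H 0%N n (erefl _)) => z; split=> [[|[j []]]|]; auto.
elim: k m => // k IH m mk /=; split.
  by apply: h; rewrite -mk addnS ltnS leq_addr.
have mk' : (m.+1 + k)%N = n by rewrite addSnnS.
apply: seq_indep_ext (IH _ mk') => z; split.
  case=> [|[j []]]; auto; rewrite ltnS leq_eqVlt => /orP [/eqP ->|]; eauto.
by case=> [[|[j [hj]]]|]; eauto; right; exists j; rewrite ltnW.
Qed.

End AlgebraicClosure.

Section Morphism.
Variables (K G : fieldType) (i : {rmorphism K -> G}).

Lemma gen_morph A z : gen_field A z -> gen_field (fun y => exists2 x, A x & y = i x) (i z).
Proof.
elim=> {z} [x h| | |x y _ hx _ hy|x _ hx|x y _ hx _ hy|x _ hx].
- by apply: gf_base; exists x.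
- by rewrite rmorph0; apply: gf_0.
- by rewrite rmorph1; apply: gf_1.
- by rewrite rmorphD; apply: gf_add.
- by rewrite rmorphN; apply: gf_opp.
- by rewrite rmorphM; apply: gf_mul.
- by rewrite fmorphV; apply: gf_inv.
Qed.

Lemma gen_morph_inv A y : gen_field (fun y => exists2 x, A x & y = i x) y ->
  exists2 x, gen_field A x & y = i x.
Proof.
elim=> {y} [_ [x hx ->]| | |_ _ _ [x hx ->] _ [y hy ->]|_ _ [x hx ->]
   |_ _ _ [x hx ->] _ [y hy ->]|_ _ [x hx ->]].
- by exists x => //; apply: gf_base.
- by exists 0; [apply: gf_0|rewrite rmorph0].
- by exists 1; [apply: gf_1|rewrite rmorph1].
- by exists (x + y); [apply: gf_add|rewrite rmorphD].
- by exists (- x); [apply: gf_opp|rewrite rmorphN].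
- by exists (x * y); [apply: gf_mul|rewrite rmorphM].
- by exists x^-1; [apply: gf_inv|rewrite fmorphV].
Qed.

(** A polynomial over the field generated by the image of [A] has its coefficients in the range of
    [i], so it pulls back to [K]. A dependence between elements of [K] can thus be carried from one
    field containing [K] to another. *)
Lemma acl_morph A z :
  acl (fun y => exists2 x, A x & y = i x) (i z) <-> acl A z.
Proof.
split=> [[p [p0 [hp pz]]]|[p [p0 [hp pz]]]]; last first.
  exists (map_poly i p); split; first by rewrite map_poly_eq0.
  by split=> [k|]; [rewrite coef_map; apply: gen_morph|rewrite fmorph_root].
have /choice [c hc] : forall k, exists x, gen_field A x /\ p`_k = i x.
  by move=> k; case: (gen_morph_inv (hp k)) => x; exists x.
pose q := \poly_(k < size p) c k.
have qE : map_poly i q = p.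
  apply/polyP => k; rewrite coef_map /= coef_poly; case: ltnP => hk.
    by case: (hc k).
  by rewrite rmorph0 nth_default.
exists q; split; first by rewrite -(map_poly_eq0 i) qE.
split; last by rewrite -(fmorph_root i) qE.
move=> k; rewrite coef_poly; case: ltnP => _; [by case: (hc k)|exact: gf_0].
Qed.

End Morphism.

(** * Formulas, transfer and saturation *)

Section Variables.
Variable P : Type.
Implicit Types (t : term P) (f : fml P) (V W : nat -> Prop).

Fixpoint vars_in V t : Prop :=
  match t with
  | TVar i => V i
  | TAdd t u | TMul t u => vars_in V t /\ vars_in V u
  | TOpp t | TDer t => vars_in V t
  | _ => True
  end.

Fixpoint tmax t : nat :=
  match t with
  | TVar i => i.+1
  | TAdd t u | TMul t u => maxn (tmax t) (tmax u)
  | TOpp t | TDer t => tmax t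
  | _ => 0%N
  end.

Fixpoint fmax f : nat :=
  match f with
  | FEq t u => maxn (tmax t) (tmax u)
  | FC t => tmax t
  | FNot f => fmax f
  | FAnd f g => maxn (fmax f) (fmax g)
  | FEx i f => maxn i.+1 (fmax f)
  end.

Lemma vars_in_mono V W t : (forall k, V k -> W k) -> vars_in V t -> vars_in W t.
Proof.
by move=> h; elim: t => //= t IHt u IHu [/IHt ? /IHu].
Qed.

Lemma vars_in_tmax t : vars_in (fun k => (k < tmax t)%N) t.
Proof.
elim: t => //= t IHt u IHu; split.
- by apply: vars_in_mono IHt => k h; rewrite leq_max h.
- by apply: vars_in_mono IHu => k h; rewrite leq_max h orbT.
- by apply: vars_in_mono IHt => k h; rewrite leq_max h.
- by apply: vars_in_mono IHu => k h; rewrite leq_max h orbT.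
Qed.

Variables (R : fieldType) (d : R -> R) (c : R -> Prop) (par : P -> R).

Lemma teval_ext v w t : vars_in (fun k => v k = w k) t ->
  teval d par v t = teval d par w t.
Proof.
by elim: t => //= [t IHt u IHu [/IHt -> /IHu ->]|t IH /IH ->
  |t IHt u IHu [/IHt -> /IHu ->]|t IH /IH ->].
Qed.

Lemma teval_agree v w t : (forall k, (k < tmax t)%N -> v k = w k) ->
  teval d par v t = teval d par w t.
Proof.
by move=> h; apply/teval_ext/(vars_in_mono _ (vars_in_tmax t)).
Qed.

Lemma sat_agree f v w : (forall k, (k < fmax f)%N -> v k = w k) ->
  sat d c par v f <-> sat d c par w f.
Proof.
elim: f v w => /= [t u|t|f IH|f IHf g IHg|i f IH] v w h.
- rewrite !(@teval_agree v w) // => k hk; apply: h; rewrite leq_max hk ?orbT //.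
- by rewrite (@teval_agree v w).
- by split=> hn /(IH v w h).
- rewrite (IHf v w) ?(IHg v w) // => k hk; apply: h; rewrite leq_max hk ?orbT //.
- have E x : sat d c par (upd v i x) f <-> sat d c par (upd w i x) f.
    apply: IH => k hk; rewrite /upd; case: ifP => // _.
    by rewrite h // leq_max hk orbT.
  by split=> -[x /E hx]; exists x.
Qed.

Lemma upd_same (v : nat -> R) i x : upd v i x i = x.
Proof. by rewrite /upd eqxx. Qed.

Lemma upd_other (v : nat -> R) i x j : j != i -> upd v i x j = v j.
Proof. by rewrite /upd => /negbTE ->. Qed.

Fixpoint fall n f : fml P :=
  if n is m.+1 then fall m (FNot (FEx m (FNot f))) else f.

Lemma sat_fall n f v : sat d c par v (fall n f) <->
  forall w, (forall k, (n <= k)%N -> w k = v k) -> sat d c par w f.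
Proof.
elim: n f v => [|n IH] f v /=.
  split=> [h w e|]; last by apply.
  by have -> : w = v by apply: functional_extensionality => k; apply: e.
rewrite IH /=; split=> [h w e|h w e].
  pose w' := upd w n (v n).
  have /h : forall k, (n <= k)%N -> w' k = v k.
    move=> k hk; rewrite /w'; have [->|kn] := eqVneq k n; first by rewrite upd_same.
    by rewrite upd_other // e // ltn_neqAle eq_sym kn.
  move=> H; apply: NNPP => hn; apply: H; exists (w n).
  have -> // : upd w' n (w n) = w.
  apply: functional_extensionality => k.
  have [->|kn] := eqVneq k n; first by rewrite upd_same.
  by rewrite /w' !upd_other.
case=> x; apply; apply: h => k hk.
by rewrite upd_other ?e //; [exact: ltnW|rewrite gtn_eqF].
Qed.

Lemma sat_fall_fmax f v : sat d c par v (fall (fmax f) f) <->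
  forall w, sat d c par w f.
Proof.
rewrite sat_fall; split=> h w => [|_]; last exact: h.
have /h : forall k, (fmax f <= k)%N ->
    (fun k => if (k < fmax f)%N then w k else v k) k = v k.
  by move=> k; rewrite ltnNge => ->.
by move/sat_agree; apply => k ->.
Qed.

Definition fimp f g := FNot (FAnd f (FNot g)).

Lemma sat_imp f g v :
  sat d c par v (fimp f g) <-> (sat d c par v f -> sat d c par v g).
Proof.
rewrite /=; split=> [h hf|h [hf hg]]; last by apply/hg/h.
by apply: NNPP => hg; apply: h.
Qed.

Definition fconj (l : seq (fml P)) := foldr (@FAnd P) (FEq TZero TZero) l.

Lemma sat_conj l v : sat d c par v (fconj l) <-> Allp (sat d c par v) l.
Proof. by elim: l => //= f l ->. Qed.

Fixpoint fallC m r f : fml P :=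
  if r is r'.+1 then FNot (FEx m (FAnd (FC (TVar P m)) (FNot (fallC m.+1 r' f)))) else f.

Lemma sat_fallC m r f v : sat d c par v (fallC m r f) <->
  forall w, (forall k, (k < m)%N || (m + r <= k)%N -> w k = v k) ->
    (forall k, (m <= k < m + r)%N -> c (w k)) -> sat d c par w f.
Proof.
elim: r m v => [|r IH] m v /=.
  split=> [h w e _|]; last by apply=> // k; rewrite addn0; case: ltnP.
  have -> // : w = v.
  by apply: functional_extensionality => k; apply: e; rewrite addn0; case: ltnP.
split=> [h w e hc|h [x [cx H]]].
  apply: NNPP => hn; apply: h; exists (w m); rewrite upd_same; split.
    by apply: hc; lia.
  move/IH => H; apply: hn; apply: H => k hk; last by apply: hc; lia.
  have [->|km] := eqVneq k m; first by rewrite upd_same.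
  by rewrite upd_other // e //; lia.
apply: H; apply/IH => w e hc; apply: h => k hk.
  by rewrite e ?upd_other //; lia.
have [->|km] := eqVneq k m; last by apply: hc; lia.
by rewrite e ?upd_same //; [rewrite upd_same in cx|lia].
Qed.

Fixpoint tpoly (ss : seq (term P)) (X : term P) : term P :=
  if ss is s :: ss' then TAdd (TMul (tpoly ss' X) X) s else TZero.

Lemma teval_tpoly ss X v : teval d par v (tpoly ss X) =
  (Poly (map (teval d par v) ss)).[teval d par v X].
Proof. by rewrite horner_Poly; elim: ss => //= s ss ->. Qed.

Lemma noDer_tpoly ss X : Allp (@noDer P) ss -> noDer X -> noDer (tpoly ss X).
Proof. by move=> + hX; elim: ss => //= s ss IH [? /IH]. Qed.

Lemma vars_in_tpoly V ss X : Allp (vars_in V) ss -> vars_in V X ->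
  vars_in V (tpoly ss X).
Proof. by move=> + hX; elim: ss => //= s ss IH [? /IH]. Qed.

Definition fzero (ss : seq (term P)) := fconj (map (fun s => FEq s TZero) ss).

Lemma sat_fzero ss v : sat d c par v (fzero ss) <->
  Allp (fun s => teval d par v s = 0) ss.
Proof. by rewrite /fzero sat_conj; elim: ss => //= s ss ->. Qed.

End Variables.

Lemma AllpP (T : Type) (Q : T -> Prop) (x0 : T) l :
  Allp Q l <-> forall i, (i < size l)%N -> Q (nth x0 l i).
Proof.
elim: l => [|x l IH] /=; first by split.
rewrite IH; split=> [[h1 h2] [|i] // hi|h]; first exact: h2.
by split=> [|i hi]; [exact: (h 0%N)|exact: (h i.+1)].
Qed.

Lemma Allp_map (T U : Type) (h : T -> U) (Q : U -> Prop) l :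
  Allp Q (map h l) <-> Allp (fun x => Q (h x)) l.
Proof. by elim: l => //= x l ->. Qed.

Lemma Allp_impl (T : Type) (Q Q' : T -> Prop) l :
  (forall x, Q x -> Q' x) -> Allp Q l -> Allp Q' l.
Proof. by move=> h; elim: l => //= x l IH [/h ? /IH]. Qed.

Lemma Allp_image (T U : Type) (h : T -> U) (Q : T -> Prop) l :
  Allp (fun y => exists2 x, Q x & y = h x) l ->
  exists2 l', Allp Q l' & l = map h l'.
Proof.
elim: l => [|y l IH] /=; first by exists [::].
case=> [[x Qx ->] /IH [l' hl' ->]]; by exists (x :: l').
Qed.

Section Transfer.
Variable L : forall P, fml P -> Prop.
Hypothesis LN : forall P (f : fml P), L f -> L (FNot f).
Hypothesis LE : forall P i (f : fml P), L f -> L (FEx i f).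
Variables (R : fieldType) (d : R -> R) (c : R -> Prop).
Variables (R' : fieldType) (d' : R' -> R') (c' : R' -> Prop) (e : R -> R').
Hypothesis he : elem_ext L d c d' c' e.

Lemma L_fall P n (f : fml P) : L f -> L (fall n f).
Proof. by elim: n f => //= n IH f hf; apply: IH; do 2?[apply: LN|apply: LE]; apply: LN. Qed.

(** [elem_ext] only speaks of valuations that come from [R]. The universal closure of [f] is a
    sentence, and its truth in [R'] covers all valuations in [R']. *)
Lemma transfer_all f : L f ->
  (forall w, sat d c id w f) <-> (forall w, sat d' c' e w f).
Proof.
move=> hf; rewrite -(sat_fall_fmax d c id f (fun=> 0)).
rewrite (he (fun=> 0) (L_fall (fmax f) hf)).
exact: sat_fall_fmax.
Qed.

End Transfer.

Section Translation.
Variables (P Q : Type) (e : P -> Q).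

Fixpoint ttr (rho : nat -> option Q) (t : term P) : term Q :=
  match t with
  | TVar i => if rho i is Some p then TPar p else TVar Q i
  | TPar p => TPar (e p)
  | TZero => TZero
  | TOne => TOne
  | TAdd t u => TAdd (ttr rho t) (ttr rho u)
  | TOpp t => TOpp (ttr rho t)
  | TMul t u => TMul (ttr rho t) (ttr rho u)
  | TDer t => TDer (ttr rho t)
  end.

(** [rho] says which variables become parameters. Below a quantifier the bound variable is withdrawn
    from [rho], so its bound occurrences stay variables. *)
Fixpoint ftr (rho : nat -> option Q) (f : fml P) : fml Q :=
  match f with
  | FEq t u => FEq (ttr rho t) (ttr rho u)
  | FC t => FC (ttr rho t)
  | FNot f => FNot (ftr rho f)
  | FAnd f g => FAnd (ftr rho f) (ftr rho g)
  | FEx i f => FEx i (ftr (fun j => if j == i then None else rho j) f)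
  end.

Lemma noDer_ttr rho t : noDer t -> noDer (ttr rho t).
Proof.
elim: t => //= [i _|t IHt u IHu [/IHt ? /IHu]|t IHt u IHu [/IHt ? /IHu]] //.
by case: (rho i).
Qed.

Lemma pair_ftr rho f : pair_fml f -> pair_fml (ftr rho f).
Proof.
elim: f rho => //= [t u rho [? ?]|t rho ?|f IHf g IHg rho [/IHf h /IHg h'] //|i f IH rho /IH //].
  by split; apply: noDer_ttr.
exact: noDer_ttr.
Qed.

Lemma diff_ftr rho f : diff_fml f -> diff_fml (ftr rho f).
Proof.
by elim: f rho => //= [f IHf g IHg rho [/IHf h /IHg h'] //|i f IH rho /IH].
Qed.

Lemma Allp_cat (T : Type) (B : T -> Prop) l l' :
  Allp B (l ++ l') <-> Allp B l /\ Allp B l'.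
Proof. by elim: l => [|x l IH] /=; [tauto|rewrite IH; tauto]. Qed.

Variable A : Q -> Prop.
Hypothesis Ae : forall p, A (e p).

Lemma term_pars_ttr rho t : (forall i p, rho i = Some p -> A p) ->
  Allp A (term_pars (ttr rho t)).
Proof.
move=> h; elim: t => //= [i|t IHt u IHu|t IHt u IHu].
- by case E : (rho i) => [p|] //=; split=> //; apply: h E.
- by rewrite Allp_cat.
- by rewrite Allp_cat.
Qed.

Lemma fml_pars_ftr rho f : (forall i p, rho i = Some p -> A p) ->
  Allp A (fml_pars (ftr rho f)).
Proof.
elim: f rho => //= [t u|t|f IHf g IHg|i f IH] rho h.
- by rewrite Allp_cat; split; apply: term_pars_ttr.
- exact: term_pars_ttr.
- by rewrite Allp_cat; split; [apply: IHf|apply: IHg].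
- by apply: IH => j p; case: ifP => // _; apply: h.
Qed.

End Translation.

Section TranslationSem.
Variables (P : Type) (R : fieldType) (d : R -> R) (c : R -> Prop) (e : P -> R).

Let ov (rho : nat -> option R) (v : nat -> R) k := if rho k is Some p then p else v k.

Lemma teval_ttr rho v t : teval d id v (ttr e rho t) = teval d e (ov rho v) t.
Proof.
rewrite /ov; elim: t => //= [i|t -> u ->|t ->|t -> u ->|t ->] //.
by case: (rho i).
Qed.

Lemma sat_ftr rho v f : sat d c id v (ftr e rho f) <-> sat d c e (ov rho v) f.
Proof.
elim: f rho v => /= [t u|t|f IH|f IHf g IHg|i f IH] rho v.
- by rewrite !teval_ttr.
- by rewrite !teval_ttr.
- by rewrite IH.
- by rewrite IHf IHg.
- have E x : ov (fun j => if j == i then None else rho j) (upd v i x) =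
      upd (ov rho v) i x.
    apply: functional_extensionality => k; rewrite /ov /upd.
    by case: (k == i).
  by split=> -[x]; rewrite ?IH ?E => h; exists x; rewrite ?IH ?E.
Qed.

End TranslationSem.

Lemma natr_injective (R : fieldType) : [pchar R] =i pred0 ->
  injective (fun n : nat => n%:R : R).
Proof.
move=> /pcharf0P h m n /=; wlog le : m n / (m <= n)%N.
  by move=> H; case: (leqP m n) => [|/ltnW] /H // H' /esym /H'.
move=> E; have /eqP : (n - m)%:R = 0 :> R by rewrite natrB // E subrr.
by rewrite h subn_eq0 => le'; apply/eqP; rewrite eqn_leq le le'.
Qed.

(* A finite set can be absorbed into an infinite one, because the natural
   numbers inside [R] can be shifted. *)
Lemma absorb_finite (R R' : fieldType) (e : R -> R') (t : seq R') :
  [pchar R] =i pred0 -> injective e ->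
  exists g : R' -> R, forall x y, ((exists z, x = e z) \/ x \in t) ->
    ((exists z, y = e z) \/ y \in t) -> g x = g y -> x = y.
Proof.
move=> ch ei; have ni := natr_injective ch.
pose m := size t.
have /choice [h hh] : forall z : R, exists z' : R,
    (exists2 k : nat, z = k%:R & z' = (k + m)%:R) \/ ((forall k : nat, z <> k%:R) /\ z' = z).
  move=> z; have [[k hk]|hk] := classic (exists k : nat, z = k%:R).
    by exists (k + m)%:R; left; exists k.
  by exists z; right; split=> // k e'; apply: hk; exists k.
have /choice [g hg] : forall x : R', exists y : R,
    (exists2 z, x = e z & y = h z) \/ ((forall z, x <> e z) /\ y = (index x t)%:R).
  move=> x; have [[z hz]|hz] := classic (exists z, x = e z).
    by exists (h z); left; exists z.
  by exists (index x t)%:R; right; split=> // z E; apply: hz; exists z.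
have hi z z' : h z = h z' -> z = z'.
  case: (hh z) => [[k -> ->]|[nz ->]]; case: (hh z') => [[k' -> ->]|[nz' ->]] //.
  - by move/ni/eqP; rewrite eqn_add2r => /eqP ->.
  - by move=> E; case: (nz' (k + m)%N).
  - by move=> E; case: (nz (k' + m)%N).
have hne z x : x \in t -> h z <> (index x t)%:R.
  rewrite -index_mem -/m => hx; case: (hh z) => [[k -> ->]|[nz ->]].
    by move/ni => E; rewrite -E ltnNge leq_addl in hx.
  exact: nz.
exists g => x y hx hy; case: (hg x) => [[z -> ->]|[nz ->]]; case: (hg y) => [[z' -> ->]|[nz' ->]].
- by move/hi ->.
- by case: hy => [[z' /nz' //]|/hne ny /ny].
- by case: hx => [[z'' /nz //]|/hne ny /esym /ny].
case: hx => [[z'' /nz //]|hx]; case: hy => [[z'' /nz' //]|hy].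
by move=> /ni E; rewrite -(nth_index 0 hx) E nth_index.
Qed.

(** Saturation is stated for valuations sending every variable to the same [x]. Replacing the
    variables below [size t] by the entries of [t] as parameters leaves exactly the valuation
    [nth x t], whose default value is [x]. The parameter set, the image of [e] together with [t], is
    small enough by [absorb_finite]. *)
Lemma saturated_tuple (L : forall P, fml P -> Prop) (R R' : fieldType)
    (d' : R' -> R') (c' : R' -> Prop) (e : R -> R') (t : seq R') (Th : fml R -> Prop) :
  (forall rho f, L R f -> L R' (ftr e rho f)) ->
  [pchar R] =i pred0 -> injective e -> saturated_over L R d' c' ->
  (forall f, Th f -> L R f) ->
  (forall l, Allp Th l -> exists x, Allp (sat d' c' e (fun k => nth x t k)) l) ->
  exists x, forall f, Th f -> sat d' c' e (fun k => nth x t k) f.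
Proof.
move=> Ltr ch ei hs hTh hfin.
have [g hg] := absorb_finite t ch ei.
pose rho k := if (k < size t)%N then Some (nth 0 t k) else None.
have ovE x : (fun k => if rho k is Some p then p else x) = (fun k => nth x t k).
  apply: functional_extensionality => k; rewrite /rho.
  by case: ltnP => hk; [apply: set_nth_default|rewrite nth_default].
pose Sigma f' := exists2 f, Th f & f' = ftr e rho f.
have [||x hx] := hs Sigma _ g hg.
- move=> _ [f hf ->]; split; first exact/Ltr/hTh.
  apply: fml_pars_ftr => [p|i p]; first by left; exists p.
  by rewrite /rho; case: ltnP => // hi [<-]; right; apply: mem_nth.
- move=> l /Allp_image [l' /hfin [x hx] ->]; exists x; apply/Allp_map.
  by apply: Allp_impl hx => f; rewrite sat_ftr ovE.
exists x => f hf; rewrite -ovE; apply/sat_ftr; apply: hx.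
by exists f.
Qed.

Lemma sat_to_diff (R : fieldType) (d : R -> R) (c0 : R -> Prop) P (par : P -> R) v f :
  pair_fml f ->
  sat id (fun x => d x = 0) par v f <-> sat d c0 par v (to_diff f).
Proof.
have tE t : noDer t -> forall w, teval id par w t = teval d par w t.
  elim: t => //= [t IHt u IHu [h h'] w|t IH h w|t IHt u IHu [h h'] w].
  - by rewrite IHt ?IHu.
  - by rewrite IH.
  - by rewrite IHt ?IHu.
elim: f v => /= [t u|t|f IH|f IHf g IHg|i f IH] v.
- by case=> h h'; rewrite !tE.
- by move=> h; rewrite !tE.
- by move=> h; rewrite IH.
- by case=> h h'; rewrite IHf ?IHg.
- by move=> h; split=> -[x hx]; exists x; move: hx; rewrite IH.
Qed.

Lemma diff_to_diff P (f : fml P) : diff_fml (to_diff f).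
Proof. by elim: f => //=. Qed.

Lemma fml_pars_to_diff P (f : fml P) : fml_pars (to_diff f) = fml_pars f.
Proof. by elim: f => //= [t|f -> g ->] //; rewrite cats0. Qed.

Lemma elem_ext_pair (R R' : fieldType) (d : R -> R) (d' : R' -> R') (e : R -> R') :
  elem_ext diff_fml d (fun=> False) d' (fun=> False) e ->
  elem_ext pair_fml id (fun x => d x = 0) id (fun x => d' x = 0) e.
Proof.
move=> h f v hf; rewrite (sat_to_diff d (fun=> False) _ _ hf).
rewrite (sat_to_diff d' (fun=> False) _ _ hf).
exact/h/diff_to_diff.
Qed.

Lemma saturated_pair (R : Type) (R' : fieldType) (d' : R' -> R') :
  saturated_over diff_fml R d' (fun=> False) ->
  saturated_over pair_fml R id (fun x : R' => d' x = 0).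
Proof.
move=> hs Sigma A g hg hS hfin.
have hp f : Sigma f -> pair_fml f by case/hS.
have [||x hx] := hs (fun f' => exists2 f, Sigma f & f' = to_diff f) A g hg.
- move=> _ [f hf ->]; rewrite fml_pars_to_diff; split; first exact: diff_to_diff.
  by case: (hS f hf).
- move=> l /Allp_image [l' hl' ->]; have [x hx] := hfin _ hl'; exists x.
  apply/Allp_map; elim: l' hl' hx => //= f l' IH [hf hl'] [hx hx'].
  by split; [apply/sat_to_diff; [apply: hp|]|apply: IH].
exists x => f hf; apply/(sat_to_diff d' (fun=> False)); first exact: hp.
by apply: hx; exists f.
Qed.

(** * Derivations and Blum's axioms *)

Lemma gen_mulrn (R : fieldType) (A : R -> Prop) x n :
  gen_field A x -> gen_field A (x *+ n).
Proof.
move=> h; elim: n => [|n IH]; first by rewrite mulr0n; apply: gf_0.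
by rewrite mulrS; apply: gf_add.
Qed.

Lemma gen_exp (R : fieldType) (A : R -> Prop) x n :
  gen_field A x -> gen_field A (x ^+ n).
Proof.
move=> h; elim: n => [|n IH]; first by rewrite expr0; apply: gf_1.
by rewrite exprS; apply: gf_mul.
Qed.

Section CharacteristicZero.
Variables (R : fieldType).
Hypothesis ch : [pchar R] =i pred0.

(** As long as the derivative also vanishes at [x], replace [p] by it: in characteristic zero it is
    nonzero and of smaller degree. *)
Lemma acl_separable A (x : R) : acl A x ->
  exists p : {poly R}, [/\ forall i, gen_field A p`_i, root p x & p^`().[x] != 0].
Proof.
case=> p [p0 [hp px]].
have [m hm] := ubnP (size p); elim: m p p0 hp px hm => // m IH p p0 hp px hm.
have [p'x|p'x] := eqVneq p^`().[x] 0; last by exists p.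
have sp : (1 < size p)%N.
  rewrite ltnNge; apply/negP => /size1_polyC pE.
  move: px p0; rewrite pE rootE hornerC => /eqP ->; by rewrite eqxx.
apply: (IH p^`()).
- apply/eqP => /(congr1 (fun q : {poly R} => q`_((size p).-2))).
  rewrite coef_deriv coef0 => /eqP.
  have -> : (size p).-2.+1 = (size p).-1 by lia.
  rewrite -lead_coefE -mulr_natr mulf_eq0 lead_coef_eq0 (negbTE p0) /=.
  by have /pcharf0P -> := ch; case: (size p) sp => [|[]].
- by move=> i; rewrite coef_deriv; apply: gen_mulrn.
- exact/eqP.
- by apply: leq_trans (lt_size_deriv p0) _; rewrite -ltnS.
Qed.

(** The product of the nonzero members of [ps] has finitely many roots, and the natural numbers are
    infinitely many. Natural numbers are chosen because they are constants. *)
Lemma poly_nonroot_nat (ps : seq {poly R}) : exists k : nat,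
  forall p, p \in ps -> p != 0 -> ~~ root p k%:R.
Proof.
pose q := \prod_(p <- ps | p != 0) p.
have q0 : q != 0 by rewrite /q prodf_seq_neq0; apply/allP => p _; apply/implyP.
have [k hk] : exists k : nat, ~~ root q k%:R.
  apply: NNPP => h.
  have hr : all (root q) (map (fun k => k%:R) (iota 0 (size q))).
    apply/allP => _ /mapP [k _ ->]; apply: NNPP => hk; apply: h.
    by exists k; apply/negP.
  have := max_poly_roots q0 hr; rewrite map_inj_uniq ?iota_uniq; last exact: natr_injective.
  by rewrite size_map size_iota ltnn => /(_ isT).
exists k => p hp p0; apply: contra hk => pk.
rewrite /q; rewrite (big_rem p) //= p0 rootM pk //.
Qed.

Lemma poly_eq0_fun (p : {poly R}) : (forall x, p.[x] = 0) -> p = 0.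
Proof.
move=> h; have [k hk] := poly_nonroot_nat [:: p].
apply/eqP/negPn/negP => p0; move: (hk p (mem_head _ _) p0).
by rewrite rootE h eqxx.
Qed.

End CharacteristicZero.

Section Derivation.
Variables (R : fieldType) (d : R -> R).
Hypotheses (hd : derivation d) (ch : [pchar R] =i pred0).

Lemma der_add x y : d (x + y) = d x + d y. Proof. by case: hd => ->. Qed.
Lemma der_mul x y : d (x * y) = d x * y + x * d y. Proof. by case: hd => _ ->. Qed.

Lemma der0 : d 0 = 0.
Proof. by apply: (addrI (d 0)); rewrite -der_add !addr0. Qed.

Lemma der1 : d 1 = 0.
Proof. by apply: (addrI (d 1)); rewrite -[in RHS](mulr1 1) der_mul mulr1 mul1r addr0. Qed.

Lemma der_opp x : d (- x) = - d x.
Proof. by apply: (addrI (d x)); rewrite -der_add !subrr der0. Qed.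

Lemma der_inv x : d x^-1 = - (d x * x^-1 * x^-1).
Proof.
have [->|x0] := eqVneq x 0; first by rewrite invr0 der0 mul0r mul0r oppr0.
have := der1; rewrite -(divff x0) der_mul => /eqP; rewrite addrC addr_eq0 => /eqP E.
by rewrite -[LHS](mulKf x0) E; ring.
Qed.

(** The summand [z] is the value at [x] of the polynomial obtained by differentiating the
    coefficients of [p]. Only a set [Z] containing it is recorded: an algebraic closure in
    [acl_der], and zero alone in [acl_const]. *)
Lemma der_horner (Z : R -> Prop) (p : {poly R}) x : Z 0 ->
  (forall z z', Z z -> Z z' -> Z (z * x + z')) -> (forall i, Z (d p`_i)) ->
  exists2 z, Z z & d p.[x] = z + p^`().[x] * d x.
Proof.
move=> Z0 ZD; elim/poly_ind: p => [|p c IH] h.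
  by exists 0 => //; rewrite deriv0 !horner0 der0; ring.
have [i|z hz E] := IH.
  by move: (h i.+1); rewrite coefD coefMX coefC addr0.
have hc : Z (d c) by move: (h 0%N); rewrite coefD coefMX coefC add0r.
exists (z * x + d c); first exact: ZD.
rewrite derivD derivM derivX derivC !hornerE der_add der_mul E; ring.
Qed.

(** Differentiating a separable equation [p.[x] = 0] expresses [d x] rationally through [x] and the
    coefficients of [p] and their derivatives. *)
Lemma acl_der A x : (forall y, A y -> acl A (d y)) -> acl A x -> acl A (d x).
Proof.
move=> hA hx.
have hg z : gen_field A z -> acl A (d z).
  elim=> {z} [z /hA //| | |y z gy hy gz hz|y gy hy|y z gy hy gz hz|y gy hy].
  - rewrite der0; exact/acl_gen/gf_0.
  - rewrite der1; exact/acl_gen/gf_0.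
  - by rewrite der_add; apply/acl_field/gf_add; apply: gf_base.
  - by rewrite der_opp; apply/acl_field/gf_opp; apply: gf_base.
  - move: gy gz => /acl_gen gy /acl_gen gz; rewrite der_mul; apply/acl_field.
    by apply/gf_add; apply: gf_mul; apply: gf_base.
  - move: gy => /acl_gen gy; rewrite der_inv; apply/acl_field/gf_opp.
    by apply/gf_mul; [apply/gf_mul; [exact: gf_base|]|]; apply/gf_inv/gf_base.
have [p [hp px p'x]] := acl_separable ch hx.
have [|z z' hz hz'|i|z hz E] := @der_horner (acl A) p x.
- exact/acl_gen/gf_0.
- by apply/acl_field/gf_add; [apply: gf_mul|]; apply: gf_base.
- exact: hg.
move: E; rewrite (rootP px) der0 => /esym/eqP; rewrite addrC addr_eq0 => /eqP E.
rewrite -[d x](mulKf p'x) E; apply/acl_field/gf_mul; last exact/gf_opp/gf_base.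
apply/gf_inv; rewrite horner_coef.
elim/big_ind: _ => [|u v|i _]; [exact: gf_0|exact: gf_add|].
apply: gf_mul.
  by rewrite coef_deriv; apply/gen_mulrn/gf_base/acl_gen.
exact/gen_exp/gf_base.
Qed.

Lemma gen_const x : gen_field (fun y => d y = 0) x -> d x = 0.
Proof.
elim=> {x} [//| | |x y _ hx _ hy|x _ hx|x y _ hx _ hy|x _ hx].
- exact: der0.
- exact: der1.
- by rewrite der_add hx hy addr0.
- by rewrite der_opp hx oppr0.
- by rewrite der_mul hx hy mul0r mulr0 addr0.
- by rewrite der_inv hx !mul0r oppr0.
Qed.

Lemma acl_const x : acl (fun y => d y = 0) x -> d x = 0.
Proof.
move=> hx; have [p [hp px p'x]] := acl_separable ch hx.
have [|z z' -> ->|i|z -> E] := @der_horner (fun z => z = 0) p x; first by [].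
- by rewrite mul0r addr0.
- exact: gen_const.
move/eqP: E; rewrite (rootP px) der0 add0r eq_sym mulf_eq0 (negbTE p'x) /=.
by move/eqP.
Qed.

Lemma acl_consts_dcl (F : fieldType) (e : F -> R) A x :
  acl (fun y => A y \/ (exists z, y = e z) \/ d y = 0) x -> dcl e d A x.
Proof.
pose B y := exists w j, (A w \/ exists z, w = e z) /\ y = iter j d w.
move=> hx; have : acl (fun y => B y \/ d y = 0) x.
  apply: acl_mono hx => y [h|[h|h]]; [left|left|by right].
    by exists y, 0%N; split; auto.
  by exists y, 0%N; split; auto.
case/acl_finite => c [hc hxc].
(* [B] is closed under [d] and the elements of [c] have derivative zero, so the algebraic closure of
   both is a differential field. *)
have hit j : acl (fun y => B y \/ y \in c) (iter j d x).
  elim: j => //= j IH; apply: acl_der IH => y [[w [i [hw ->]]]|/hc ->].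
    by apply: acl_base; left; exists w, i.+1.
  exact/acl_gen/gf_0.
apply: NNPP => hn.
(* If [dcl] fails, then for every [k] the [k]-th derivative is not algebraic over [B] and the
   earlier ones. *)
have hi : seq_indep B (map (fun j => iter j d x) (iota 0 (size c).+1)).
  by apply: seq_indep_iota => k _ h; apply: hn; exists k.
have : (size (map (fun j => iter j d x) (iota 0 (size c).+1)) <= size c)%N.
  by apply: steinitz hi _ => _ /mapP [j _ ->].
by rewrite size_map size_iota ltnn.
Qed.

End Derivation.

Section Blum.
Variables (R : fieldType) (d : R -> R).
Hypothesis hdc : diff_closed d.

(** Taking for [f] the last variable, which has order exactly [k], makes Blum's axiom applicable to
    any [g]; only the inequation is retained. *)
Lemma blum_nonvanishing k (g : {mpoly R[k]}) : g != 0 ->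
  exists a, g.@[fun i => iter i d a] != 0.
Proof.
move=> g0; have [|a [_ ha]] := hdc (k := k) (f := 'X_ord_max) (g := g) _ g0; last by exists a.
exists U_(ord_max)%MM; first by rewrite msuppX mem_seq1.
by rewrite mnm1E eqxx.
Qed.

(** Blum's axiom in order 0, with [p] written in the single variable and [g] equal to 1. *)
Lemma diff_closed_root (p : {poly R}) : (1 < size p)%N -> exists a, root p a.
Proof.
move=> sp; pose f : {mpoly R[1]} := \sum_(i < size p) p`_i *: 'X_[U_(ord_max) *+ i].
have [|a [ha _]] := hdc (k := 0) (f := f) (g := 1) _ (oner_neq0 _).
  exists (U_(ord_max) *+ (size p).-1)%MM; last first.
    by rewrite mulmnE mnm1E eqxx mul1n; lia.
  rewrite mcoeff_msupp /f raddf_sum /=.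
  have hi : ((size p).-1 < size p)%N by lia.
  rewrite (bigD1 (Ordinal hi)) //= big1 ?addr0.
    rewrite mcoeffZ mcoeffX eqxx mulr1 -lead_coefE lead_coef_eq0.
    by rewrite -size_poly_gt0 (ltn_trans _ sp).
  move=> i ne; rewrite mcoeffZ mcoeffX; case: eqP => [E|]; last by rewrite mulr0.
  case/eqP: ne; apply: val_inj => /=.
  move/(congr1 (fun m : 'X_{1..1} => m ord_max)): E.
  by rewrite !mulmnE mnm1E eqxx !mul1n.
exists a; rewrite rootE -{}ha horner_coef /f raddf_sum /=.
apply/eqP/eq_bigr => i _; by rewrite mevalZ -mpolyXn rmorphXn /= mevalXU.
Qed.

End Blum.

(** * Differentially generic tuples *)

Section Substitution.
Variables (P : Type).

Fixpoint tsubst (sigma : nat -> term P) (t : term P) : term P :=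
  match t with
  | TVar i => sigma i
  | TPar p => TPar p
  | TZero => TZero
  | TOne => TOne
  | TAdd t u => TAdd (tsubst sigma t) (tsubst sigma u)
  | TOpp t => TOpp (tsubst sigma t)
  | TMul t u => TMul (tsubst sigma t) (tsubst sigma u)
  | TDer t => TDer (tsubst sigma t)
  end.

Lemma teval_tsubst (R : fieldType) (d : R -> R) (par : P -> R) v sigma t :
  teval d par v (tsubst sigma t) = teval d par (fun k => teval d par v (sigma k)) t.
Proof. by elim: t => //= [t -> u ->|t ->|t -> u ->|t ->]. Qed.

Lemma noDer_tsubst sigma t : (forall k, noDer (sigma k)) -> noDer t ->
  noDer (tsubst sigma t).
Proof.
by move=> h; elim: t => //= t IHt u IHu [/IHt ? /IHu].
Qed.

Lemma vars_in_tsubst (V W : nat -> Prop) sigma t : vars_in V t ->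
  (forall k, V k -> vars_in W (sigma k)) -> vars_in W (tsubst sigma t).
Proof.
by move=> + h; elim: t => //= t IHt u IHu [/IHt ? /IHu].
Qed.

Lemma teval_noDer (R : fieldType) (d : R -> R) (par : P -> R) v t :
  noDer t -> teval d par v t = teval id par v t.
Proof.
by elim: t => //= [t IHt u IHu [/IHt -> /IHu ->]|t IH /IH ->|t IHt u IHu [/IHt -> /IHu ->]].
Qed.

Lemma teval_iterDer (R : fieldType) (d : R -> R) (par : P -> R) v j t :
  teval d par v (iter j (@TDer P) t) = iter j d (teval d par v t).
Proof. by elim: j => //= j ->. Qed.

End Substitution.

Section TermPolynomial.
Variables (R : fieldType) (J : nat) (sel : nat -> option nat) (w : nat -> R).

(** [sel] splits the variables into unknowns and variables frozen at [w]. The value 0 for indices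
    beyond [J] and for [TDer] is a default, excluded by the hypotheses of [meval_term_mpoly]. *)
Fixpoint term_mpoly (t : term R) : {mpoly R[J]} :=
  match t with
  | TVar k => if sel k is Some j then
      (if insub j is Some i then 'X_(i : 'I_J) else 0) else (w k)%:MP
  | TPar p => p%:MP
  | TZero => 0
  | TOne => 1
  | TAdd t u => term_mpoly t + term_mpoly u
  | TOpp t => - term_mpoly t
  | TMul t u => term_mpoly t * term_mpoly u
  | TDer t => 0
  end.

Lemma meval_term_mpoly (X : nat -> R) t : noDer t ->
  vars_in (fun k => forall j, sel k = Some j -> (j < J)%N) t ->
  (term_mpoly t).@[fun i => X i] =
  teval id id (fun k => if sel k is Some j then X j else w k) t.
Proof.
elim: t => /= [k _ h|p|||t IHt u IHu [a b] [a' b']|t IH a b|t IHt u IHu [a b] [a' b']|] //.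
- case E: (sel k) => [j|]; last by rewrite mevalC.
  by rewrite (insubT (fun j => j < J)%N (h _ E)) mevalXU.
- by rewrite mevalC.
- by rewrite meval0.
- by rewrite meval1.
- by rewrite mevalD IHt ?IHu.
- by rewrite mevalN IH.
- by rewrite mevalM IHt ?IHu.
Qed.

End TermPolynomial.

Section BlumTerms.
Variables (F : fieldType) (delta : F -> F).
Hypothesis hdc : diff_closed delta.

Lemma blum_term (sel : nat -> option nat) (w X : nat -> F) s : noDer s ->
  (forall k j, sel k = Some j -> (j <= k)%N) ->
  teval id id (fun k => if sel k is Some j then X j else w k) s != 0 ->
  exists a, teval id id (fun k => if sel k is Some j then iter j delta a else w k) s != 0.
Proof.
move=> ns hsel hX.
have hv : vars_in (fun k => forall j, sel k = Some j -> (j < tmax s)%N) s.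
  by apply: vars_in_mono (vars_in_tmax s) => k hk j /hsel hj; apply: leq_ltn_trans hk.
have [|a ha] := @blum_nonvanishing _ _ hdc _ (term_mpoly (tmax s) sel w s).
  by apply: contraNneq hX => E; rewrite -(meval_term_mpoly _ _ ns hv) E meval0.
by exists a; move: ha; rewrite (meval_term_mpoly w (fun j => iter j delta a) ns hv).
Qed.

(** The two polynomials are nonzero, hence so is their product, and Blum's axiom provides a point
    where it does not vanish. *)
Lemma nonvanishing_mul (s u : term F) : noDer s -> noDer u ->
  (exists w, teval id id w s != 0) -> (exists w, teval id id w u != 0) ->
  exists w, teval id id w (TMul s u) != 0.
Proof.
move=> ns nu [w hw] [w' hw'].
pose J := maxn (tmax s) (tmax u).
have hs : vars_in (fun k => forall j, Some k = Some j -> (j < J)%N) s.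
  by apply: vars_in_mono (vars_in_tmax s) => k hk j [<-]; rewrite leq_max hk.
have hu : vars_in (fun k => forall j, Some k = Some j -> (j < J)%N) u.
  by apply: vars_in_mono (vars_in_tmax u) => k hk j [<-]; rewrite leq_max hk orbT.
have [|a ha] := @blum_nonvanishing _ _ hdc _ (term_mpoly J some w s * term_mpoly J some w u).
  apply: mulf_neq0.
    by apply: contraNneq hw => E; rewrite -(meval_term_mpoly w w ns hs) E meval0.
  by apply: contraNneq hw' => E; rewrite -(meval_term_mpoly w w' nu hu) E meval0.
exists (fun j => iter j delta a); move: ha.
by rewrite mevalM !(meval_term_mpoly w (fun j => iter j delta a)).
Qed.

End BlumTerms.

Section Generic.
Variables (F : fieldType) (delta : F -> F).
Hypotheses (hdc : diff_closed delta) (ch : [pchar F] =i pred0).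
Variables (F2 : fieldType) (d2 : F2 -> F2) (e2 : {rmorphism F -> F2}).
Hypothesis he : elem_ext diff_fml delta (fun=> False) d2 (fun=> False) e2.
Hypothesis hs : saturated_over diff_fml F d2 (fun=> False).
(* The variable [k] of a term stands for the [k %/ n]-th derivative of the
   [k %% n]-th coordinate. *)
Variable n : nat.
Hypothesis n_gt0 : (0 < n)%N.

Definition prolong (b : seq F2) (k : nat) : F2 :=
  iter (k %/ n)%N d2 (nth 0 b (k %% n)%N).

(** Differential independence over [F] of the first [l] coordinates: [s] is a differential
    polynomial whose derivatives are written as separate variables, and that it is zero is expressed
    by its vanishing everywhere on the infinite field [F]. *)
Definition generic (l : nat) (b : seq F2) : Prop :=
  forall s, noDer s -> vars_in (fun k => (k %% n < l)%N) s ->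
    teval id e2 (prolong b) s = 0 -> forall w, teval id id w s = 0.

Let sel l k := if (k %% n == l)%N then Some (k %/ n)%N else None.

(** For a fixed [s] this is first-order: the new element is the variable [M], fresh for [s], and the
    variables of the [l]-th block are replaced by its iterated derivatives. The sentence holds in
    [F] by Blum's axiom. *)
Lemma transfer_blum l s (v : nat -> F2) : noDer s ->
  teval id e2 v s != 0 ->
  exists x, teval id e2 (fun k => if (k %% n == l)%N then iter (k %/ n)%N d2 x else v k) s != 0.
Proof.
move=> ns hv.
pose M := tmax s.
pose sigma k := if sel l k is Some j then iter j (@TDer F) (TVar F M) else TVar F k.
pose f := fimp (FNot (FEq s TZero)) (FEx M (FNot (FEq (tsubst sigma s) TZero))).
have sem (R : fieldType) (d : R -> R) (par : F -> R) w x :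
    teval d par (upd w M x) (tsubst sigma s) =
    teval id par (fun k => if sel l k is Some j then iter j d x else w k) s.
  rewrite teval_tsubst teval_noDer //; apply: teval_agree => k hk.
  rewrite /sigma; case: (sel l k) => [j|]; first by rewrite teval_iterDer /= upd_same.
  by rewrite /= upd_other // neq_ltn hk.
have fF w : sat delta (fun=> False) id w f.
  apply/sat_imp => /=; rewrite teval_noDer // => /eqP hw.
  (* The values of [w] on the [l]-th block show that the polynomial in this block is nonzero; Blum's
     axiom trades them for the derivatives of a single element. *)
  have [||a ha] := @blum_term _ _ hdc (sel l) w (fun j => w (j * n + l)%N) s ns.
  - by move=> k j; rewrite /sel; case: ifP => // _ [<-]; apply: leq_div.
  - move: hw; congr (_ != 0); apply: teval_agree => k _; rewrite /sel.
    by case: eqP => // <-; rewrite -divn_eq.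
  by exists a; rewrite sem; apply/eqP.
have LN : forall P (f : fml P), diff_fml f -> diff_fml (FNot f) by [].
have LE : forall P i (f : fml P), diff_fml f -> diff_fml (FEx i f) by [].
have df : diff_fml f by [].
have := (transfer_all LN LE he df).1 fF v; move/sat_imp => /=.
rewrite teval_noDer // => /(_ (elimN eqP hv)) [x]; rewrite sem => /eqP hx.
exists x; move: hx; congr (_ != 0); apply: teval_agree => k _; rewrite /sel.
by case: (k %% n == l)%N.
Qed.

(** The type to realize says that no nonzero differential polynomial over [F] vanishes at [b] and
    [x]. A finite part of it reduces to a single inequation, by taking the product. *)
Lemma generic_rcons l b : (l < n)%N -> size b = l -> generic l b ->
  exists x, generic l.+1 (rcons b x).
Proof.
move=> ln sb hb.
pose sigma k := iter (k %/ n)%N (@TDer F) (TVar F (k %% n)%N).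
pose ok (s : term F) := [/\ noDer s, vars_in (fun k => (k %% n < l.+1)%N) s
  & exists w, teval id id w s != 0].
pose Th f := exists2 s, ok s & f = FNot (FEq (tsubst sigma s) TZero).
have sem s x : noDer s -> vars_in (fun k => (k %% n < l.+1)%N) s ->
    teval d2 e2 (fun k => nth x b k) (tsubst sigma s) = teval id e2 (prolong (rcons b x)) s.
  move=> ns vs; rewrite teval_tsubst teval_noDer //; apply: teval_ext.
  apply: vars_in_mono vs => k hk; rewrite teval_iterDer /= /prolong nth_rcons sb.
  move: hk; rewrite ltnS leq_eqVlt => /orP [/eqP ->|hk].
    by rewrite ltnn eqxx nth_default ?sb.
  by rewrite hk (set_nth_default 0) ?sb.
have ei : injective e2 by exact: fmorph_inj.
have [|||x hx] := @saturated_tuple diff_fml F F2 d2 (fun=> False) e2 b Th _ ch ei hs.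
- by move=> rho f; apply: diff_ftr.
- by move=> _ [s _ ->].
- move=> fs /Allp_image [ss hss ->].
  have [s [ns vs [w hw] hdiv]] : exists s, [/\ noDer s,
      vars_in (fun k => (k %% n < l.+1)%N) s, exists w, teval id id w s != 0
      & forall v, teval id e2 v s != 0 -> Allp (fun u => teval id e2 v u != 0) ss].
    elim: ss hss => [_|u ss IH /= [[nu vu hu] /IH [s [ns vs hw hdiv]]]].
      by exists TOne; split=> //; exists (fun=> 0); rewrite /= oner_neq0.
    exists (TMul u s); split=> //; first exact: (nonvanishing_mul hdc).
    by move=> v /=; rewrite mulf_eq0 negb_or => /andP [-> /hdiv].
  (* With values of [F] in the new block, [s'] only involves [b], and genericity of [b] keeps it
     from vanishing. [transfer_blum] then replaces these values by genuine derivatives. *)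
  pose s' := tsubst (fun k => if (k %% n == l)%N then TPar (w k) else TVar F k) s.
  have s'0 : teval id e2 (prolong b) s' != 0.
    apply/eqP => E.
    have ns' : noDer s' by apply: noDer_tsubst => // k; case: ifP.
    have vs' : vars_in (fun k => (k %% n < l)%N) s'.
      apply: vars_in_tsubst vs _ => k; rewrite ltnS leq_eqVlt.
      by case: ifP => //= _ hk.
    have := hb _ ns' vs' E w; rewrite teval_tsubst => H.
    move/eqP: hw; apply; rewrite -[RHS]H; apply: teval_agree => k _.
    by case: ifP.
  rewrite teval_tsubst in s'0.
  have [x hx] := transfer_blum l ns s'0.
  exists x; apply/Allp_map.
  have : teval id e2 (prolong (rcons b x)) s != 0.
    move: hx; congr (_ != 0); apply: teval_ext; apply: vars_in_mono vs => k.
    rewrite ltnS leq_eqVlt /prolong nth_rcons sb.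
    by case: eqP => [->|_ /= ->]; rewrite ?ltnn ?eqxx.
  move/hdiv => H; elim: ss hss H {hdiv} => //= u ss IH [[nu vu _] hss] [hu /IH H].
  by split; [rewrite sem //; apply/eqP|apply: H].
exists x => s ns vs E w; apply: NNPP => hw.
have /hx /= : Th (FNot (FEq (tsubst sigma s) TZero)).
  by exists s => //; split=> //; exists w; apply/eqP.
by rewrite sem.
Qed.

Lemma generic_exists l : (l <= n)%N -> exists2 b, size b = l & generic l b.
Proof.
elim: l => [|l IH] hl.
  exists [::] => // s ns vs E w; apply: (fmorph_inj e2); rewrite rmorph0 -E.
  have vs' : vars_in (fun=> False) s by apply: vars_in_mono vs => k; rewrite ltn0.
  elim: s {ns vs E} vs' => //= [_|_|t IHt u IHu [/IHt <- /IHu <-]|t IHt /IHt <-|t IHt u IHu [/IHt <- /IHu <-]].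
  - by rewrite rmorph0.
  - by rewrite rmorph1.
  - by rewrite rmorphD.
  - by rewrite rmorphN.
  - by rewrite rmorphM.
have [b sb gb] := IH (ltnW hl).
by have [x hx] := generic_rcons hl sb gb; exists (rcons b x) => //; rewrite size_rcons sb.
Qed.

Lemma e2_iter j z : e2 (iter j delta z) = iter j d2 (e2 z).
Proof.
have h x : e2 (delta x) = d2 (e2 x).
  have := (@he (FEq (TDer (TPar x)) (TPar (delta x))) (fun=> 0) I).1 (erefl _).
  by move=> /= ->.
by elim: j => //= j <-.
Qed.

(** A dependence of order [k], cleared of denominators, is a differential polynomial vanishing at
    [b]. By genericity it vanishes identically on [F], hence so does each of its coefficients in the
    [k]-th derivative of coordinate [i]. They then vanish on [F2], so the dependence was trivial. *)
Lemma generic_not_dcl l b i (A : F2 -> Prop) : generic l b -> (l <= n)%N -> (i < l)%N ->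
  (forall y, A y -> exists j, [/\ (j < l)%N, j != i & y = nth 0 b j]) ->
  ~ dcl e2 d2 A (nth 0 b i).
Proof.
move=> gb ln il hA [k [p [p0 [hp px]]]].
(* The variables allowed in coefficients: all but the derivatives of coordinate [i] of order at
   least [k]. In particular the main variable [k * n + i] does not occur in them. *)
pose V q := (q %% n < l)%N /\ ~ ((q %% n)%N = i /\ (k <= q %/ n)%N).
pose R z := exists s, [/\ noDer s, vars_in V s & z = teval id e2 (prolong b) s].
have hR : subring_pred R.
  split.
  - by exists TZero.
  - by exists TOne.
  - by move=> _ _ [s [? ? ->]] [u [? ? ->]]; exists (TAdd s u).
  - by move=> _ [s [? ? ->]]; exists (TOpp s).
  - by move=> _ _ [s [? ? ->]] [u [? ? ->]]; exists (TMul s u).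
have pv j q : (j < n)%N -> ((q * n + j) %% n = j)%N /\ ((q * n + j) %/ n = q)%N.
  by move=> hj; rewrite modnMDl modn_small // divnMDl // divn_small // addn0.
have hW y : (exists w j, (A w \/ exists z, w = e2 z) /\ y = iter j d2 w)
    \/ (exists j, (j < k)%N /\ y = iter j d2 (nth 0 b i)) -> R y.
  case=> [[w [q [[/hA [j [hj ji ->]]|[z ->]] ->]]]|[q [hq ->]]].
  - have [E1 E2] := pv j q (leq_trans hj ln).
    exists (TVar F (q * n + j)%N); split=> //=; last by rewrite /prolong E1 E2.
    by rewrite /V E1 E2; split=> // -[/eqP E _]; rewrite E in ji.
  - by exists (TPar (iter q delta z)); split=> //=; rewrite e2_iter.
  - have [E1 E2] := pv i q (leq_trans il ln).
    exists (TVar F (q * n + i)%N); split=> //=; last by rewrite /prolong E1 E2.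
    by rewrite /V E1 E2; split=> // -[_]; rewrite leqNgt hq.
have [w [_ w0 /choice [c hc]]] := clear_denominators hR hW hp.
pose ss := map c (iota 0 (size p)).
have nss : Allp (@noDer F) ss by apply/Allp_map; elim: (iota _ _) => //= j js; split=> //; case: (hc j).
have vss : Allp (vars_in V) ss by apply/Allp_map; elim: (iota _ _) => //= j js; split=> //; case: (hc j).
have ssE : Poly (map (teval id e2 (prolong b)) ss) = w *: p.
  apply/polyP => j; rewrite coef_Poly coefZ -map_comp.
  have [hj|hj] := ltnP j (size p).
    rewrite (nth_map 0%N) ?size_iota // nth_iota //= add0n.
    by case: (hc j).
  by rewrite !nth_default ?mulr0 // size_map size_iota.
have [E1 E2] := pv i k (leq_trans il ln).
pose s := tpoly ss (TVar F (k * n + i)%N).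
have vs : vars_in (fun q => (q %% n < l)%N) s.
  apply: vars_in_tpoly; last by rewrite /= E1.
  by apply: Allp_impl vss => u; apply: vars_in_mono => q [].
have sE : teval id e2 (prolong b) s = 0.
  by rewrite teval_tpoly ssE hornerZ /= /prolong E1 E2 (rootP px) mulr0.
have ns : noDer s by apply: noDer_tpoly.
have s0 := gb s ns vs sE.
have ss0 u : Allp (fun t => teval id id u t = 0) ss.
  have P0 : Poly (map (teval id id u) ss) = 0.
    apply: (poly_eq0_fun ch) => x.
    have := s0 (upd u (k * n + i)%N x); rewrite teval_tpoly /= upd_same => H.
    rewrite -[RHS]H; congr (Poly _).[_]; elim: {s vs sE s0 ns nss ssE H} ss vss => //= t ts IH [vt /IH ->].
    congr (_ :: _); apply: teval_ext; apply: vars_in_mono vt => q [_ hq].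
    by rewrite upd_other //; apply/eqP => E; apply: hq; rewrite E E1 E2.
  apply/(AllpP _ TZero) => j hj.
  by have := congr1 (fun q : {poly F} => q`_j) P0; rewrite coef0 coef_Poly (nth_map TZero).
have [j hj] : exists j, p`_j != 0 by exists (size p).-1; rewrite -lead_coefE lead_coef_eq0.
have : w * p`_j = 0.
  have hjp : (j < size p)%N by rewrite ltnNge; apply: contra hj => hj; rewrite nth_default.
  case: (hc j) => nc _ ->.
  have LN : forall P (f : fml P), diff_fml f -> diff_fml (FNot f) by [].
  have LE : forall P i (f : fml P), diff_fml f -> diff_fml (FEx i f) by [].
  have H : forall u, sat delta (fun=> False) id u (FEq (c j) TZero).
    move=> u /=; rewrite teval_noDer //.
    have := (AllpP _ TZero _).1 (ss0 u) j; rewrite size_map size_iota => /(_ hjp).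
    by rewrite (nth_map 0%N) ?size_iota // nth_iota.
  have := (transfer_all LN LE he (I : diff_fml (FEq (c j) TZero))).1 H (prolong b).
  by rewrite /= teval_noDer.
by move/eqP; rewrite mulf_eq0 (negbTE w0) (negbTE hj).
Qed.

End Generic.

(** * Saturated pairs *)

Lemma pair_fallC P m r (f : fml P) : pair_fml f -> pair_fml (fallC m r f).
Proof. by elim: r m => //= r IH m /IH. Qed.

Lemma pair_fconj P (l : seq (fml P)) : Allp (@pair_fml P) l -> pair_fml (fconj l).
Proof. by elim: l => //= f l IH [? /IH]. Qed.

Lemma pair_fzero P (ss : seq (term P)) : Allp (@noDer P) ss -> pair_fml (fzero ss).
Proof. by move=> h; apply/pair_fconj/Allp_map/(Allp_impl _ h). Qed.

Lemma Allp_iota (Q : nat -> Prop) r :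
  Allp Q (iota 0 r) <-> forall i, (i < r)%N -> Q i.
Proof.
rewrite (AllpP _ 0%N) size_iota; split=> h i hi.
  by have := h i hi; rewrite nth_iota.
by rewrite nth_iota //; apply: h.
Qed.

Section FreeOver.
Variables (P : Type).

(* With [m] parameters in the variables below [m]: the variable [M] is not a
   root of a nonzero polynomial with coefficients [ss] evaluated at the
   parameters and at [r] elements of the predicate. *)
Definition free_fml m r (ss : seq (term P)) M : fml P :=
  fallC m r (fimp (FEq (tpoly ss (TVar P M)) TZero) (fzero ss)).

Lemma pair_free_fml m r ss M : Allp (@noDer P) ss -> pair_fml (free_fml m r ss M).
Proof.
move=> h; apply: pair_fallC => /=; split; last exact: pair_fzero.
by split=> //; apply: noDer_tpoly.
Qed.

Variables (R : fieldType) (d : R -> R) (c : R -> Prop) (par : P -> R).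

Definition free_sem m r (ss : seq (term P)) (u : nat -> R) x : Prop :=
  forall w, (forall k, (k < m)%N -> w k = u k) ->
    (forall k, (m <= k < m + r)%N -> c (w k)) ->
    (Poly (map (teval d par w) ss)).[x] = 0 -> Allp (fun s => teval d par w s = 0) ss.

Lemma sat_free_fml m r ss M v : (m + r <= M)%N ->
  Allp (vars_in (fun k => (k < m + r)%N)) ss ->
  sat d c par v (free_fml m r ss M) <-> free_sem m r ss v (v M).
Proof.
move=> hM hss; rewrite sat_fallC.
have agree w w' : (forall k, (k < m + r)%N -> w k = w' k) ->
    map (teval d par w) ss = map (teval d par w') ss.
  move=> h; elim: ss hss => //= s ss IH [hs /IH ->]; congr (_ :: _).
  by apply: teval_ext; apply: vars_in_mono hs.
have agree0 w : Allp (fun s => teval d par w s = 0) ss <->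
    Allp (fun z => z = 0) (map (teval d par w) ss) by rewrite Allp_map.
split=> [h w e hc E|h w e hc].
  pose w' k := if (k < m + r)%N then w k else v k.
  have ww' : forall k, (k < m + r)%N -> w' k = w k by move=> k; rewrite /w' => ->.
  have := h w' _ _; rewrite sat_imp sat_fzero /= teval_tpoly !agree0 !(agree _ _ ww') /=.
  apply.
  - move=> k /orP [hk|hk]; rewrite /w'; last by rewrite ltnNge hk.
    by rewrite e //; case: ifP.
  - by move=> k /andP [h1 h2]; rewrite ww' //; apply: hc; rewrite h1.
  - by rewrite /w' ltnNge hM.
rewrite sat_imp sat_fzero /= teval_tpoly /= => E; apply: h => //.
- by move=> k hk; apply: e; rewrite hk.
- by rewrite -e ?hM ?orbT.
Qed.

End FreeOver.

(** Everything the back-and-forth uses about a pair, so that it can treat [<F1, C1>] and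
    [<F2, ker delta2>] symmetrically. The field [good_lin] is the linear disjointness of [F] and [C]
    over [ker delta]. *)
Record good_pair (F : fieldType) (delta : F -> F) (G : fieldType) (C : G -> Prop)
    (e : {rmorphism F -> G}) : Prop := GoodPair {
  good_const : forall z, C (e z) <-> delta z = 0;
  good_free : forall t : seq G, exists x,
    ~ acl (fun y => ((exists z, y = e z) \/ y \in t) \/ C y) x;
  good_free_const : forall t : seq G, exists2 x, C x &
    ~ acl (fun y => (exists z, y = e z) \/ y \in t) x;
  good_root : forall p : {poly G}, (1 < size p)%N -> exists a, root p a;
  good_acl : forall x, acl C x -> C x;
  good_lin : forall r (h : nat -> F),
    (forall c : nat -> F, (forall i, delta (c i) = 0) ->
       \sum_(i < r) c i * h i = 0 -> forall i, (i < r)%N -> c i = 0) ->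
    forall c : nat -> G, (forall i, C (c i)) ->
       \sum_(i < r) c i * e (h i) = 0 -> forall i, (i < r)%N -> c i = 0 }.

Section GoodPair.
Variables (F : fieldType) (delta : F -> F).
Hypotheses (hd : derivation delta) (ch : [pchar F] =i pred0) (hdc : diff_closed delta).
Notation C0 := (fun x => delta x = 0).
Variables (G : fieldType) (C : G -> Prop) (e : {rmorphism F -> G}).
Hypothesis he : elem_ext pair_fml id C0 id C e.
Hypothesis hs : saturated_over pair_fml F id C.
Variables (G' : fieldType) (C' : G' -> Prop) (e' : {rmorphism F -> G'}).
Hypothesis he' : elem_ext pair_fml id C0 id C' e'.
Variable x0 : G'.
Hypothesis hx0 : ~ acl (fun y => (exists z, y = e' z) \/ C' y) x0.

Let LN P (f : fml P) : pair_fml f -> pair_fml (FNot f). Proof. by []. Qed.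
Let LE P i (f : fml P) : pair_fml f -> pair_fml (FEx i f). Proof. by []. Qed.

Let up f : pair_fml f -> (forall w, sat id C0 id w f) -> forall w, sat id C e w f.
Proof. by move=> hf /(transfer_all LN LE he hf). Qed.

Let chG : [pchar G] =i pred0.
Proof. by move=> p; rewrite (fmorph_pchar e). Qed.

Lemma pair_const z : C (e z) <-> delta z = 0.
Proof.
by have /= <- := @he (FC (TPar z)) (fun=> 0) I.
Qed.

Lemma pair_root (p : {poly G}) : (1 < size p)%N -> exists a, root p a.
Proof.
(* For monic polynomials of a given degree, the existence of a root is a sentence about the lower
   coefficients alone. *)
move=> sp; pose q := (lead_coef p)^-1 *: p.
have lp : lead_coef p != 0 by rewrite lead_coef_eq0 -size_poly_gt0 ltnW.
have sq : size q = size p by rewrite size_scale ?invr_eq0.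
pose n := (size p).-1.
pose ss := rcons (map (TVar F) (iota 0 n)) TOne.
pose f := FEx n (FEq (tpoly ss (TVar F n)) TZero).
have nss : Allp (@noDer F) ss.
  by rewrite /ss -cats1 Allp_cat Allp_map; split=> //; elim: (iota 0 n) => //=.
have pf : pair_fml f by split=> //; apply: noDer_tpoly.
have ssE (R : fieldType) (par : F -> R) (w : nat -> R) x :
    map (teval id par (upd w n x)) ss = rcons (map w (iota 0 n)) 1.
  rewrite /ss map_rcons /=; congr rcons; rewrite -map_comp; apply/eq_in_map => k.
  by rewrite mem_iota add0n /= => hk; rewrite upd_other // ltn_eqF.
have hF w : sat id C0 id w f.
  have [|a ha] := @diff_closed_root _ _ hdc (Poly (rcons (map w (iota 0 n)) 1)).
    rewrite (@PolyK _ 0) ?last_rcons ?oner_neq0 //.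
    by rewrite size_rcons size_map size_iota /n; lia.
  by exists a; rewrite /= teval_tpoly ssE /= upd_same; apply/eqP.
have [a] := up pf hF (fun k => q`_k); rewrite /= teval_tpoly ssE /= upd_same => ha.
exists a; have qE : Poly (rcons [seq q`_k | k <- iota 0 n] 1) = q.
  apply/polyP => k; rewrite coef_Poly nth_rcons size_map size_iota.
  case: ltngtP => hk.
  - by rewrite (nth_map 0%N) ?size_iota // nth_iota.
  - by rewrite nth_default // sq; move: hk; rewrite /n; lia.
  - by rewrite hk /n -sq -lead_coefE lead_coefZ mulVf.
by move: ha; rewrite qE hornerZ => /eqP; rewrite mulf_eq0 invr_eq0 (negbTE lp).
Qed.

Lemma pair_gen_const x : gen_field C x -> C x.
Proof.
elim=> {x} [//| | |x y _ hx _ hy|x _ hx|x y _ hx _ hy|x _ hx].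
- by rewrite -(rmorph0 e); apply/pair_const/der0.
- by rewrite -(rmorph1 e); apply/pair_const/der1.
- pose f := fimp (FAnd (FC (TVar F 0)) (FC (TVar F 1))) (FC (TAdd (TVar F 0) (TVar F 1))).
  have /up : pair_fml f by [].
  move=> /(_ _ (fun k => if k == 0%N then x else y)) /sat_imp; apply=> //.
  by move=> w; apply/sat_imp => /= -[h1 h2]; rewrite der_add // h1 h2 addr0.
- pose f := fimp (FC (TVar F 0)) (FC (TOpp (TVar F 0))).
  have /up : pair_fml f by [].
  move=> /(_ _ (fun k => x)) /sat_imp; apply=> //.
  by move=> w; apply/sat_imp => /= h1; rewrite der_opp // h1 oppr0.
- pose f := fimp (FAnd (FC (TVar F 0)) (FC (TVar F 1))) (FC (TMul (TVar F 0) (TVar F 1))).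
  have /up : pair_fml f by [].
  move=> /(_ _ (fun k => if k == 0%N then x else y)) /sat_imp; apply=> //.
  by move=> w; apply/sat_imp => /= -[h1 h2]; rewrite der_mul // h1 h2 mul0r mulr0 addr0.
- have [->|x_n0] := eqVneq x 0; first by rewrite invr0 -(rmorph0 e); apply/pair_const/der0.
  pose f := fimp (FAnd (FC (TVar F 0)) (FEq (TMul (TVar F 0) (TVar F 1)) TOne)) (FC (TVar F 1)).
  have /up : pair_fml f by [].
  move=> /(_ _ (fun k => if k == 0%N then x else x^-1)) /sat_imp; apply.
    move=> w; apply/sat_imp => /= -[h1 h2].
    have -> : w 1%N = (w 0%N)^-1.
      by rewrite -[RHS]mulr1 -h2 mulKf //; apply: contra_eq_neq h2 => ->; rewrite mul0r eq_sym oner_neq0.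
    by rewrite der_inv // h1 !mul0r oppr0.
  by split=> //=; rewrite divff.
Qed.

(** For each degree, that a root of a monic polynomial over the constants is constant is a sentence;
    it holds in [F] by [acl_const]. *)
Lemma pair_acl x : acl C x -> C x.
Proof.
case=> p [p0 [hp px]].
pose q := (lead_coef p)^-1 *: p.
have lp : lead_coef p != 0 by rewrite lead_coef_eq0.
have sq : size q = size p by rewrite size_scale ?invr_eq0.
have hq i : C q`_i.
  by apply: pair_gen_const; rewrite coefZ; apply: gf_mul => //; apply: gf_inv; apply: hp.
pose n := (size p).-1.
pose ss := rcons (map (TVar F) (iota 0 n)) TOne.
have nss : Allp (@noDer F) ss.
  by rewrite /ss -cats1 Allp_cat Allp_map; split=> //; elim: (iota 0 n) => //=.
pose f := fimp (FAnd (fconj (map (fun k => FC (TVar F k)) (iota 0 n)))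
  (FEq (tpoly ss (TVar F n)) TZero)) (FC (TVar F n)).
have pf : pair_fml f.
  split=> //; split; last by split=> //; apply: noDer_tpoly.
  by apply/pair_fconj/Allp_map; elim: (iota 0 n).
have ssE (R : fieldType) (par : F -> R) (w : nat -> R) :
    map (teval id par w) ss = rcons (map w (iota 0 n)) 1.
  by rewrite /ss map_rcons -map_comp.
have hF w : sat id C0 id w f.
  apply/sat_imp; rewrite /= sat_conj Allp_map Allp_iota /= teval_tpoly ssE => -[hw E].
  apply: (acl_const hd ch); exists (Poly (rcons (map w (iota 0 n)) 1)).
  split; first by rewrite -size_poly_gt0 (@PolyK _ 0) ?last_rcons ?oner_neq0 // size_rcons.
  split; last exact/eqP.
  move=> i; rewrite coef_Poly nth_rcons size_map size_iota; case: ltngtP => hi.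
  - by apply: gf_base; rewrite (nth_map 0%N) ?size_iota // nth_iota //; apply: hw.
  - exact: gf_0.
  - exact: gf_1.
have := up pf hF (fun k => if (k < n)%N then q`_k else x) => /sat_imp.
rewrite /= ltnn; apply; rewrite sat_conj Allp_map Allp_iota teval_tpoly ssE /= ltnn.
split; first by move=> i hi; rewrite hi.
rewrite (_ : Poly _ = q); first by rewrite hornerZ (rootP px) mulr0.
apply/polyP => k; rewrite coef_Poly nth_rcons size_map size_iota.
case: ltngtP => hk.
- by rewrite (nth_map 0%N) ?size_iota // nth_iota // add0n hk.
- rewrite nth_default // sq; move: hk; rewrite /n.
  by case: (size p) => // *; apply: leq_ltn_trans.
- by rewrite hk /n -sq -lead_coefE lead_coefZ mulVf.
Qed.

(** With the [h i] as parameters and [r] fixed, linear independence over the predicate is a single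
    formula. *)
Lemma pair_lin r (h : nat -> F) :
  (forall c : nat -> F, (forall i, delta (c i) = 0) ->
     \sum_(i < r) c i * h i = 0 -> forall i, (i < r)%N -> c i = 0) ->
  forall c : nat -> G, (forall i, C (c i)) ->
     \sum_(i < r) c i * e (h i) = 0 -> forall i, (i < r)%N -> c i = 0.
Proof.
move=> hF c hc hsum.
pose tlin := fix tlin m : term F :=
  if m is m'.+1 then TAdd (tlin m') (TMul (TVar F m') (TPar (h m'))) else TZero.
have tlinE (R : fieldType) (par : F -> R) (w : nat -> R) m :
    teval id par w (tlin m) = \sum_(i < m) w i * par (h i).
  by elim: m => /= [|m ->]; rewrite ?big_ord0 ?big_ord_recr.
pose f := fimp (FAnd (fconj (map (fun k => FC (TVar F k)) (iota 0 r))) (FEq (tlin r) TZero))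
  (fzero (map (TVar F) (iota 0 r))).
have pf : pair_fml f.
  split; [split; last by split=> //; elim: (r)|].
    by apply/pair_fconj/Allp_map; elim: (iota 0 r).
  by apply/pair_fzero/Allp_map; elim: (iota 0 r).
have H w : sat id C0 id w f.
  apply/sat_imp; rewrite sat_fzero /= sat_conj !Allp_map !Allp_iota /= tlinE => -[hw E] i hi.
  have := hF (fun k => if (k < r)%N then w k else 0) _ _ i hi; rewrite hi; apply.
    by move=> k; case: ifP => [/hw //|_]; apply: der0.
  by rewrite -[RHS]E; apply: eq_bigr => k _; rewrite ltn_ord.
have := up pf H c => /sat_imp.
rewrite sat_fzero /= sat_conj !Allp_map !Allp_iota /= tlinE; apply; split=> // i _; exact: hc.
Qed.

Let ei : injective e. Proof. exact: fmorph_inj. Qed.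

Let Ltr rho f : pair_fml f -> pair_fml (ftr e rho f). Proof. exact: pair_ftr. Qed.

(* Clears denominators in an algebraic dependence of [x] on [t] and on
   finitely many elements [c] of the predicate. *)
Lemma not_acl_free (t c : seq G) x : (forall y, y \in c -> C y) ->
  (forall ss, Allp (@noDer F) ss -> Allp (vars_in (fun k => (k < size t + size c)%N)) ss ->
    free_sem id C e (size t) (size c) ss (fun k => nth x t k) x) ->
  ~ acl (fun y => ((exists z, y = e z) \/ y \in t) \/ y \in c) x.
Proof.
move=> hc hfree [p [p0 [hp px]]].
pose N := (size t + size c)%N; pose v k := nth x (t ++ c) k.
pose R z := exists s, [/\ noDer s, vars_in (fun k => (k < N)%N) s & z = teval id e v s].
have hR : subring_pred R.
  split.
  - by exists TZero.
  - by exists TOne.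
  - by move=> _ _ [s [? ? ->]] [u [? ? ->]]; exists (TAdd s u).
  - by move=> _ [s [? ? ->]]; exists (TOpp s).
  - by move=> _ _ [s [? ? ->]] [u [? ? ->]]; exists (TMul s u).
have hW y : ((exists z, y = e z) \/ y \in t) \/ y \in c -> R y.
  case=> [[[z ->]|hy]|hy]; first by exists (TPar z).
    have hy' : y \in t ++ c by rewrite mem_cat hy.
    by exists (TVar F (index y (t ++ c))); split=> //=; rewrite ?/v ?nth_index // /N -size_cat index_mem.
  have hy' : y \in t ++ c by rewrite mem_cat hy orbT.
  by exists (TVar F (index y (t ++ c))); split=> //=; rewrite ?/v ?nth_index // /N -size_cat index_mem.
have [w [_ w0 /choice [cf hcf]]] := clear_denominators hR hW hp.
pose ss := map cf (iota 0 (size p)).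
have ssE : Poly (map (teval id e v) ss) = w *: p.
  apply/polyP => j; rewrite coef_Poly coefZ -map_comp.
  have [hj|hj] := ltnP j (size p).
    rewrite (nth_map 0%N) ?size_iota // nth_iota //= add0n.
    by case: (hcf j).
  by rewrite !nth_default ?mulr0 // size_map size_iota.
have := hfree ss _ _ v; rewrite ssE => /(_ _ _ _ _ _) H.
have {H} : Allp (fun s => teval id e v s = 0) ss.
  apply: H.
  - by apply/Allp_map; elim: (iota _ _) => //= j js; split=> //; case: (hcf j).
  - by apply/Allp_map; elim: (iota _ _) => //= j js; split=> //; case: (hcf j).
  - by move=> k hk; rewrite /v nth_cat hk.
  - move=> k /andP [h1 h2]; apply: hc; rewrite /v nth_cat ltnNge h1 /=.
    by apply: mem_nth; rewrite ltn_subLR.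
  - by rewrite hornerZ (rootP px) mulr0.
rewrite /ss Allp_map Allp_iota => /(_ (size p).-1).
rewrite prednK ?size_poly_gt0 // => /(_ (leqnn _)).
case: (hcf (size p).-1) => _ _ <- /eqP.
by rewrite mulf_eq0 (negbTE w0) -lead_coefE lead_coef_eq0 (negbTE p0).
Qed.

(** Finitely many conditions exclude the roots of finitely many nonzero polynomials, and some
    natural number, which lies in [C], avoids them all. *)
Lemma pair_free_const (t : seq G) : exists2 x, C x &
  ~ acl (fun y => (exists z, y = e z) \/ y \in t) x.
Proof.
pose m := size t.
pose ok (ss : seq (term F)) := Allp (@noDer F) ss /\ Allp (vars_in (fun k => (k < m)%N)) ss.
pose Th f := f = FC (TVar F m) \/ exists2 ss, ok ss & f = free_fml m 0 ss m.
have vm ss : ok ss -> Allp (vars_in (fun k => (k < m + 0)%N)) ss by rewrite addn0 => -[].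
have semm ss x : ok ss -> sat id C e (fun k => nth x t k) (free_fml m 0 ss m) <->
    free_sem id C e m 0 ss (fun k => nth x t k) x.
  by move=> hss; rewrite sat_free_fml ?addn0 //; [rewrite nth_default|case: hss].
have [||x hx] := @saturated_tuple pair_fml F G id C e t Th Ltr ch ei hs.
- by move=> _ [->|[ss [nss _] ->]] //; apply: pair_free_fml.
- move=> fs hfs.
  have [ps hps] : exists ps : seq {poly G}, forall x, C x ->
      (forall p, p \in ps -> p != 0 -> ~~ root p x) ->
      Allp (sat id C e (fun k => nth x t k)) fs.
    elim: fs hfs => [_|f fs IH /= [hf /IH [ps hps]]]; first by exists [::].
    case: hf => [->|[ss hss ->]].
      by exists ps => x Cx hx; split; [rewrite /= nth_default|apply: hps].
    exists (Poly (map (teval id e (fun k => nth 0 t k)) ss) :: ps) => x Cx hx.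
    split; last by apply: hps => // p hp; apply: hx; rewrite inE hp orbT.
    apply/semm => // w hw _.
    have -> : map (teval id e w) ss = map (teval id e (fun k => nth 0 t k)) ss.
      case: hss => _; elim: ss {hx} => //= s ss IHs [vs /IHs ->]; congr (_ :: _).
      apply: teval_ext; apply: vars_in_mono vs => k hk.
      by rewrite hw //; apply: set_nth_default.
    move=> /eqP hr.
    have P0 : Poly [seq teval id e (fun k => t`_k) i | i <- ss] = 0.
      by apply: contraTeq hr => /(hx _ (mem_head _ _)).
    apply/(AllpP _ TZero) => j hj.
    have := congr1 (fun q : {poly G} => q`_j) P0; rewrite coef0 coef_Poly (nth_map TZero) // => <-.
    apply: teval_ext; have [_ /(AllpP _ TZero)/(_ j hj)] := hss.
    by apply: vars_in_mono => k hk; rewrite hw //; apply: set_nth_default.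
  have [k hk] := poly_nonroot_nat chG ps.
  exists k%:R; apply: hps => //.
  apply: pair_gen_const; rewrite -[k%:R]/(1 *+ k); exact/gen_mulrn/gf_1.
exists x.
  by have := hx _ (or_introl (erefl _)); rewrite /= nth_default.
move=> hacl; apply: (@not_acl_free t [::] x) => //; last first.
  by apply: acl_mono hacl => y; auto.
move=> ss nss vss; rewrite addn0 in vss.
by apply/semm => //; apply: hx; right; exists ss.
Qed.

(** The type says that [x] satisfies no nontrivial polynomial whose coefficients are terms in [t]
    and in [r] elements of the predicate, for every [r]. Its finite satisfiability in [G] comes from
    the single element [x0] of the other extension [G'], by way of [F]. *)
Lemma pair_free (t : seq G) : exists x,
  ~ acl (fun y => ((exists z, y = e z) \/ y \in t) \/ C y) x.
Proof.
pose m := size t.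
pose ok (x : nat * seq (term F)) :=
  Allp (@noDer F) x.2 /\ Allp (vars_in (fun k => (k < m + x.1)%N)) x.2.
pose fr M (x : nat * seq (term F)) := free_fml m x.1 x.2 M.
pose Th f := exists2 x, ok x & f = fr (m + x.1)%N x.
have [||x hx] := @saturated_tuple pair_fml F G id C e t Th Ltr ch ei hs.
- by move=> _ [x [nss _] ->] //; apply: pair_free_fml.
- move=> fs; rewrite /Th => /Allp_image [l hl ->].
  (* Each formula has its main variable just after its own quantified block; a conjunction needs a
     common variable [M] beyond all these blocks. *)
  have [M hM mM] : exists2 M,
      Allp (fun x : nat * seq (term F) => (m + x.1 <= M)%N) l & (m <= M)%N.
    elim: l {hl} => [|x l [M IH mM]]; first by exists m.
    exists (maxn (m + x.1) M); last by rewrite leq_max mM orbT.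
    rewrite /= leq_maxl; split=> //.
    by apply: Allp_impl IH => y hy; rewrite leq_max hy orbT.
  pose f := FEx M (fconj (map (fr M) l)).
  have pf : pair_fml f.
    apply/pair_fconj/Allp_map; apply: Allp_impl hl => x [nss _].
    exact: pair_free_fml.
  have hF w : sat id C0 id w f.
    (* To prove the sentence in [F] for parameters [w], it is read in [G'] at their images. There
       [x0] meets all the conditions at once, as it is not algebraic over [F] and [C']. *)
    apply/(he' w pf); exists x0; rewrite sat_conj Allp_map.
    elim: l hl hM {f pf} => //= -[r ss] l IH [[/= nss vss] hl] [/= rM hM].
    split; last exact: IH.
    apply/(sat_free_fml _ _ _ _ rM vss) => u hu hc; rewrite upd_same => E.
    have tg s : noDer s -> vars_in (fun k => (k < m + r)%N) s ->
        gen_field (fun y => (exists z, y = e' z) \/ C' y) (teval id e' u s).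
      elim: s => //= [k _ hk|p _ _|_ _|_ _|s IHs s' IHs' [? ?] [? ?]|s IHs ? ?|s IHs s' IHs' [? ?] [? ?]].
      - apply: gf_base; have [km|km] := ltnP k m.
          left; exists (w k); rewrite hu // upd_other //.
          by rewrite ltn_eqF // (leq_trans km).
        by right; apply: hc; rewrite km.
      - by apply: gf_base; left; exists p.
      - exact: gf_0.
      - exact: gf_1.
      - by apply: gf_add; auto.
      - by apply: gf_opp; auto.
      - by apply: gf_mul; auto.
    have P0 : Poly (map (teval id e' u) ss) = 0.
      apply/eqP/negPn/negP => P0; apply: hx0; exists (Poly (map (teval id e' u) ss)).
      split=> //; split; last exact/eqP.
      move=> i; rewrite coef_Poly; have [hi|hi] := ltnP i (size ss); last first.
        by rewrite nth_default ?size_map //; apply: gf_0.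
      rewrite (nth_map TZero) //; apply: tg.
        by move/(AllpP _ TZero): nss; apply.
      by move/(AllpP _ TZero): vss; apply.
    apply/(AllpP _ TZero) => j hj.
    by have := congr1 (fun q : {poly G'} => q`_j) P0; rewrite coef0 coef_Poly (nth_map TZero).
  have [x] : exists x, sat id C e (upd (fun k => nth 0 t k) M x) (fconj (map (fr M) l)).
    exact: up pf hF _.
  rewrite sat_conj Allp_map => hx.
  exists x; rewrite Allp_map; elim: l hl hM hx {f pf hF} => //= -[r ss] l IH.
  move=> [[/= nss vss] hl] [/= rM hM] [hx hxl].
  split; last exact: IH.
  move: hx; rewrite !(sat_free_fml _ _ _ _ _ vss) // upd_same nth_default ?leq_addr //.
  move=> H u hu; apply: H => k hk; rewrite hu // upd_other; last by rewrite ltn_eqF // (leq_trans hk).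
  exact: set_nth_default.
exists x => /acl_finite [c [hc]]; apply: not_acl_free => // ss nss vss.
have /hx : Th (fr (m + size c)%N (size c, ss)) by exists (size c, ss).
by rewrite sat_free_fml // nth_default ?leq_addr.
Qed.

Lemma pair_good : good_pair delta C e.
Proof.
split.
- exact: pair_const.
- exact: pair_free.
- exact: pair_free_const.
- exact: pair_root.
- exact: pair_acl.
- exact: pair_lin.
Qed.

End GoodPair.

(** * Descent to the constants and simple extensions *)

Lemma mk_rmorphism (K G : fieldType) (f : K -> G) :
  {morph f : x y / x + y} -> f 1 = 1 -> {morph f : x y / x * y} ->
  exists g : {rmorphism K -> G}, (g : K -> G) = f.
Proof.
move=> hD h1 hM.
have h0 : f 0 = 0 by apply: (addrI (f 0)); rewrite -hD !addr0.
have hB : zmod_morphism f.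
  by move=> x y; apply: (addIr (f y)); rewrite -hD !subrK.
have hm : monoid_morphism f by [].
pose g : {rmorphism K -> G} := HB.pack f (GRing.isZmodMorphism.Build K G f hB)
  (GRing.isMonoidMorphism.Build K G f hm).
by exists g.
Qed.

Section ConstantDescent.
Variables (F : fieldType) (delta : F -> F) (hd : derivation delta).
Variables (G : fieldType) (C : G -> Prop) (e : {rmorphism F -> G}).
Hypothesis good : good_pair delta C e.
Variable D : G -> Prop.
Hypothesis DC : forall y, D y -> C y.

Let E0 y := (exists2 z, delta z = 0 & y = e z) \/ D y.
Let E := gen_field E0.

Let gen_C x : gen_field C x -> C x.
Proof. by move=> /acl_gen /(good_acl good). Qed.

Let EC y : E y -> C y.
Proof.
by move=> h; apply/gen_C/(gen_mono _ h) => z [[w hw ->]|/DC //]; apply/(good_const good).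
Qed.

(* A dependence [\sum e (h k) *: q k] of minimal length has the [h k] linearly
   independent over the constants of [F], hence over [C]. *)
Lemma dependence_descent r (h : nat -> F) (q : nat -> {poly G}) u : C u ->
  (forall k i, E (q k)`_i) ->
  \sum_(k < r) e (h k) *: q k != 0 ->
  root (\sum_(k < r) e (h k) *: q k) u -> acl E0 u.
Proof.
move=> Cu; elim: r h q => [|r IH] h q hq; first by rewrite big_ord0 eqxx.
set P := \sum_(k < _) _ => P0 Pu.
have [hlin|] := classic (forall c : nat -> F, (forall i, delta (c i) = 0) ->
       \sum_(i < r.+1) c i * h i = 0 -> forall i, (i < r.+1)%N -> c i = 0).
  (* The values [(q k).[u]] are constants, as [u] and the coefficients are. Linear disjointness
     makes them all zero, and any nonzero [q k] witnesses that [u] is algebraic. *)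
  have hz := good_lin good hlin (c := fun k => (q k).[u]) _.
  have {}hz : forall k, (k < r.+1)%N -> (q k).[u] = 0.
    apply: hz => [k|].
      apply: gen_C; rewrite horner_coef; elim/big_ind: _ => [|a b|j _].
      - exact: gf_0.
      - exact: gf_add.
      - apply: gf_mul; last exact/gen_exp/gf_base.
        exact/gf_base/EC.
    rewrite -[RHS](rootP Pu) /P horner_sum.
    by apply: eq_bigr => k _; rewrite hornerZ mulrC.
  have [k hk qk] : exists2 k, (k < r.+1)%N & q k != 0.
    apply: NNPP => hn; case/eqP: P0; rewrite /P big1 // => k _.
    have [->|qk] := eqVneq (q k) 0; first by rewrite scaler0.
    by case: hn; exists k.
  by exists (q k); do 2?split=> //; [move=> i; exact: hq|apply/rootP; exact: hz].
move=> hlin.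
have [c [m [hc hsum hm cm]]] : exists (c : nat -> F) m, [/\ forall i, delta (c i) = 0,
    \sum_(i < r.+1) c i * h i = 0, (m < r.+1)%N & c m != 0].
  apply: NNPP => hn; apply: hlin => c hc hsum i hi; apply/eqP/negPn/negP => ci.
  by apply: hn; exists c, i.
pose M := Ordinal hm.
pose h' k := h (bump m k).
(* Solving the linear relation for [h m] and substituting shortens the sum; the ratios
   [c (bump m k) / c m] are constants, so the new polynomials still have coefficients in [E]. *)
pose q' k := q (bump m k) - e (c (bump m k) / c m) *: q m.
have dq z : delta (c z / c m) = 0.
  by rewrite (der_mul hd) (der_inv hd) (hc z) (hc m) !mul0r oppr0 mulr0 addr0.
have PE : P = \sum_(k < r) e (h' k) *: q' k.
  rewrite /P (bigD1_ord M) //=.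
  have hmE : h m = - \sum_(k < r) (c (bump m k) / c m) * h' k.
    move: hsum; rewrite (bigD1_ord M) //= => /eqP; rewrite addr_eq0 => /eqP H.
    rewrite -[h m](mulKf cm) H mulrN mulr_sumr; congr (- _).
    by apply: eq_bigr => k _; rewrite /h' /= [(c m)^-1 * _]mulrC mulrAC.
  rewrite hmE rmorphN rmorph_sum /= scaleNr scaler_suml -sumrN -big_split /=.
  apply: eq_bigr => k _; rewrite /q' scalerBr scalerA addrC.
  by rewrite -rmorphM [h' k * _]mulrC.
rewrite PE in P0 Pu; apply: (IH h' q') => // k i.
rewrite coefB coefZ; apply: gf_add; first exact: hq.
apply/gf_opp/gf_mul; last exact: hq.
by apply: gf_base; left; exists (c (bump m k) / c m).
Qed.

(** Cleared of denominators, a polynomial over [F] and [D] is a combination, with coefficients from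
    [F], of polynomials over the field generated by [ker delta] and [D]; [dependence_descent]
    applies to such combinations. *)
Lemma const_descent u : C u -> acl (fun y => (exists z, y = e z) \/ D y) u -> acl E0 u.
Proof.
move=> Cu [p [p0 [hp pu]]].
pose R z := exists2 l : seq (F * G), Allp (fun x => E x.2) l & z = \sum_(x <- l) e x.1 * x.2.
have hR : subring_pred R.
  split.
  - by exists [::] => //; rewrite big_nil.
  - exists [:: (1, 1)]; first by split=> //; apply: gf_1.
    by rewrite big_seq1 rmorph1 mulr1.
  - move=> _ _ [l hl ->] [l' hl' ->]; exists (l ++ l'); first by rewrite Allp_cat.
    by rewrite big_cat.
  - move=> _ [l hl ->]; exists (map (fun x => (x.1, - x.2)) l).
      by rewrite Allp_map; apply: Allp_impl hl => x hx; apply: gf_opp.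
    by rewrite big_map -sumrN; apply: eq_bigr => x _; rewrite mulrN.
  - move=> _ _ [l hl ->] [l' hl' ->].
    exists [seq (x.1 * y.1, x.2 * y.2) | x <- l, y <- l'].
      elim: l hl => //= x l IH [hx /IH H]; rewrite Allp_cat; split=> //.
      by rewrite Allp_map; apply: Allp_impl hl' => y hy; apply: gf_mul.
    rewrite big_allpairs_dep mulr_suml; apply: eq_bigr => x _; rewrite mulr_sumr.
    by apply: eq_bigr => y _; rewrite rmorphM mulrACA.
have hW y : (exists z, y = e z) \/ D y -> R y.
  case=> [[z ->]|hy].
    exists [:: (z, 1)]; first by split=> //; apply: gf_1.
    by rewrite big_seq1 mulr1.
  exists [:: (1, y)]; first by split=> //; apply: gf_base; right.
  by rewrite big_seq1 rmorph1 mul1r.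
have [w [_ w0 hw]] := clear_denominators hR hW hp.
pose S (P : {poly G}) := exists2 l : seq (F * {poly G}),
  Allp (fun x : F * {poly G} => forall i, E x.2`_i) l & P = \sum_(x <- l) e x.1 *: x.2.
have [l hl lE] : S (w *: p).
  have -> : w *: p = \sum_(i < size p) (w * p`_i) *: 'X^i.
    by rewrite -{1}[p]coefK poly_def scaler_sumr; apply: eq_bigr => i _; rewrite scalerA.
  elim/big_ind: _ => [|_ _ [l hl ->] [l' hl' ->]|i _].
  - by exists [::] => //; rewrite big_nil.
  - by exists (l ++ l'); [rewrite Allp_cat|rewrite big_cat].
  have [l hl ->] := hw i; exists (map (fun x => (x.1, x.2 *: 'X^i)) l).
    rewrite Allp_map; apply: Allp_impl hl => x hx j /=.
    by rewrite coefZ coefXn; apply: gf_mul => //; case: eqP => _; [apply: gf_1|apply: gf_0].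
  by rewrite big_map scaler_suml; apply: eq_bigr => x _; rewrite scalerA.
rewrite (big_nth (0, 0)) big_mkord in lE.
apply: (@dependence_descent (size l) (fun k => (nth (0, 0) l k).1) (fun k => (nth (0, 0) l k).2)).
- exact: Cu.
- move=> k i; have [hk|hk] := ltnP k (size l); first by move/(AllpP _ (0, 0)): hl; apply.
  by rewrite (nth_default (0, 0) hk) /= coef0; apply: gf_0.
- by rewrite -lE scaler_eq0 (negbTE w0).
- by rewrite -lE rootE hornerZ (rootP pu) mulr0.
Qed.

End ConstantDescent.

Section SimpleExtension.
Variables (K G1 G2 : fieldType) (i1 : {rmorphism K -> G1}) (i2 : {rmorphism K -> G2}).
Variables (x : G1) (y : G2).
Hypothesis same_kernel : forall q : {poly K},
  ((map_poly i1 q).[x] == 0) = ((map_poly i2 q).[y] == 0).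

(** [K'] is the subfield of [G1] generated by the image of [K] and [x]. It maps to [G2] by sending
    [q(x) / r(x)] to [q(y) / r(y)], which is well defined because [x] and [y] annihilate the same
    polynomials. *)
Lemma simple_extension : exists (K' : fieldType) (j : {rmorphism K -> K'})
    (i1' : {rmorphism K' -> G1}) (i2' : {rmorphism K' -> G2}) (xi : K'),
  [/\ forall z, i1' (j z) = i1 z, forall z, i2' (j z) = i2 z, i1' xi = x, i2' xi = y
    & forall z, gen_field (fun u => (exists w, u = j w) \/ u = xi) z].
Proof.
pose A u := (exists w, u = i1 w) \/ u = x.
pose K' : fieldType := gen_type A; pose i1' := gen_inj A.
have inj1 : injective i1' by exact: fmorph_inj.
have /choice [j0 hj0] : forall w, exists u : K', i1' u = i1 w.
  by move=> w; apply/gen_lift/gf_base; left; exists w.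
have [xi hxi] : exists u : K', i1' u = x by apply/gen_lift/gf_base; right.
have [||| j jE] := @mk_rmorphism K K' j0.
- by move=> a b; apply: inj1; rewrite rmorphD !hj0 rmorphD.
- by apply: inj1; rewrite hj0 !rmorph1.
- by move=> a b; apply: inj1; rewrite rmorphM !hj0 rmorphM.
have hj w : i1' (j w) = i1 w by rewrite jE.
pose ev1 (q : {poly K}) := (map_poly i1 q).[x].
pose ev2 (q : {poly K}) := (map_poly i2 q).[y].
have ev1D p q : ev1 (p + q) = ev1 p + ev1 q by rewrite /ev1 rmorphD hornerD.
have ev1M p q : ev1 (p * q) = ev1 p * ev1 q by rewrite /ev1 rmorphM hornerM.
have ev2D p q : ev2 (p + q) = ev2 p + ev2 q by rewrite /ev2 rmorphD hornerD.
have ev2M p q : ev2 (p * q) = ev2 p * ev2 q by rewrite /ev2 rmorphM hornerM.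
have ev1N q : ev1 (- q) = - ev1 q by rewrite /ev1 rmorphN hornerN.
have ev2N q : ev2 (- q) = - ev2 q by rewrite /ev2 rmorphN hornerN.
have frac (z : K') : exists qr : {poly K} * {poly K},
    ev1 qr.2 != 0 /\ i1' z * ev1 qr.2 = ev1 qr.1.
  pose R u := exists q, u = ev1 q.
  have hR : subring_pred R.
    split.
    - by exists 0; rewrite /ev1 rmorph0 horner0.
    - by exists 1; rewrite /ev1 rmorph1 hornerE.
    - by move=> _ _ [p ->] [q ->]; exists (p + q).
    - by move=> _ [p ->]; exists (- p).
    - by move=> _ _ [p ->] [q ->]; exists (p * q).
  have hA u : A u -> R u.
    case=> [[w ->]|->]; first by exists w%:P; rewrite /ev1 map_polyC hornerC.
    by exists 'X; rewrite /ev1 map_polyX hornerX.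
  have [_ [_ [[q ->] [r ->] r0 E]]] := gen_fraction hR hA (gen_typeP z).
  by exists (q, r).
have [fr hfr] := choice _ frac.
pose f z := ev2 (fr z).1 / ev2 (fr z).2.
have fE z q r : ev1 r != 0 -> i1' z * ev1 r = ev1 q -> f z = ev2 q / ev2 r.
  move=> r0 E; have [r0' E'] := hfr z.
  have : ev2 ((fr z).1 * r - q * (fr z).2) == 0.
    rewrite /ev2 -same_kernel -/(ev1 _) ev1D ev1N !ev1M -E -E'; apply/eqP; ring.
  rewrite ev2D ev2N !ev2M subr_eq0 /f => /eqP H.
  have r2 : ev2 r != 0 by rewrite /ev2 -same_kernel.
  have r2' : ev2 (fr z).2 != 0 by rewrite /ev2 -same_kernel.
  by apply/eqP; rewrite eqr_div // H.
have ev11 : ev1 1 = 1 by rewrite /ev1 rmorph1 hornerE.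
have ev21 : ev2 1 = 1 by rewrite /ev2 rmorph1 hornerE.
have r2 z : ev2 (fr z).2 != 0 by rewrite /ev2 -same_kernel; case: (hfr z).
have [||| i2' i2E] := @mk_rmorphism K' G2 f.
- move=> a b; have [ra Ea] := hfr a; have [rb Eb] := hfr b.
  rewrite (fE (a + b) ((fr a).1 * (fr b).2 + (fr b).1 * (fr a).2) ((fr a).2 * (fr b).2)).
  + by rewrite ev2D !ev2M /f -addf_div.
  + by rewrite ev1M mulf_neq0.
  + rewrite ev1D !ev1M rmorphD -Ea -Eb; ring.
- by rewrite (fE 1 1 1) ?ev21 ?divr1 // ev11 ?oner_neq0 // rmorph1 mulr1.
- move=> a b; have [ra Ea] := hfr a; have [rb Eb] := hfr b.
  rewrite (fE (a * b) ((fr a).1 * (fr b).1) ((fr a).2 * (fr b).2)).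
  + by rewrite !ev2M /f mulf_div.
  + by rewrite ev1M mulf_neq0.
  + rewrite !ev1M rmorphM -Ea -Eb; ring.
exists K', j, i1', i2', xi; split=> //.
- move=> z; rewrite i2E (fE (j z) z%:P 1) ?ev21 ?divr1 ?ev11 ?oner_neq0 //.
    by rewrite /ev2 map_polyC hornerC.
  by rewrite hj mulr1 /ev1 map_polyC hornerC.
- rewrite i2E (fE xi 'X 1) ?ev21 ?divr1 ?ev11 ?oner_neq0 //.
    by rewrite /ev2 map_polyX hornerX.
  by rewrite hxi mulr1 /ev1 map_polyX hornerX.
move=> z; have [|u hu /inj1 -> //] :=
    @gen_morph_inv K' G1 i1' (fun u => (exists w, u = j w) \/ u = xi) (i1' z).
apply: gen_mono (gen_typeP z) => u [[w ->]|->].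
  by exists (j w); rewrite ?hj //; left; exists w.
by exists xi; [right|rewrite hxi].
Qed.

End SimpleExtension.

(** * Back and forth *)

(* [cs] collects the constants of [K]; the last condition says that [K] and [C]
   are algebraically independent over [F] and [cs]. *)
Definition free_embedding (F G : fieldType) (C : G -> Prop) (e : F -> G) (K : fieldType)
    (f0 : F -> K) (i : K -> G) (cs : seq K) : Prop :=
  [/\ forall z, i (f0 z) = e z, forall c, c \in cs -> C (i c) &
    forall (d : seq G) u, (forall y, y \in d -> C y) -> C u ->
      acl (fun y => (exists z, y = i z) \/ y \in d) u ->
      acl (fun y => (exists z, y = e z) \/ ((exists2 c, c \in cs & y = i c) \/ y \in d)) u].

Section OneSide.
Variables (F G : fieldType) (C : G -> Prop) (e : F -> G) (K : fieldType).
Variables (f0 : F -> K) (i : {rmorphism K -> G}) (cs : seq K).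
Hypothesis hi : free_embedding C e f0 i cs.
Variables (K' : fieldType) (j : {rmorphism K -> K'}) (i' : {rmorphism K' -> G}) (xi : K').
Hypothesis ij : forall z, i' (j z) = i z.
Hypothesis hgen : forall z, gen_field (fun u => (exists w, u = j w) \/ u = xi) z.

Lemma range_extension z : gen_field (fun y => (exists w, y = i w) \/ y = i' xi) (i' z).
Proof.
apply: gen_mono (gen_morph i' (hgen z)) => y [x [[w ->]|->] ->]; last by right.
by left; exists w.
Qed.

Lemma free_embedding_alg : acl (fun y => exists w, y = i w) (i' xi) ->
  free_embedding C e (j \o f0) i' (map j cs).
Proof.
case: hi => h1 h2 h3 hx; split.
- by move=> z /=; rewrite ij.
- by move=> _ /mapP [c hc ->]; rewrite ij; apply: h2.
move=> d u hd Cu hu; apply: acl_mono (h3 d u hd Cu _).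
  move=> y [|[[c hc ->]|]]; auto; right; left; exists (j c); rewrite ?ij //.
  exact: map_f.
apply: acl_trans hu => y [[z ->]|hy]; last by apply: acl_base; right.
apply: acl_trans (acl_gen (range_extension z)) => v [[w ->]|->].
  by apply: acl_base; left; exists w.
by apply: acl_mono hx => v'; left.
Qed.

Lemma free_embedding_const : C (i' xi) ->
  free_embedding C e (j \o f0) i' (xi :: map j cs).
Proof.
case: hi => h1 h2 h3 hx; split.
- by move=> z /=; rewrite ij.
- move=> c; rewrite inE => /orP [/eqP -> //|/mapP [c' hc ->]].
  by rewrite ij; apply: h2.
move=> d u hd Cu hu; apply: acl_mono (h3 (i' xi :: d) u _ Cu _).
- move=> y [|[[c hc ->]|]]; auto.
    by right; left; exists (j c); rewrite ?ij // inE map_f ?orbT.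
  rewrite inE => /orP [/eqP ->|]; auto.
  by right; left; exists xi; rewrite ?inE ?eqxx.
- by move=> y; rewrite inE => /orP [/eqP ->|/hd].
apply: acl_trans hu => y [[z ->]|hy].
  apply: acl_mono (acl_gen (range_extension z)) => v [|->]; auto.
  by right; rewrite inE eqxx.
by apply: acl_base; right; rewrite inE hy orbT.
Qed.

(** If a constant became algebraic only thanks to the new element, exchange would make that element
    algebraic over [K] and [C]. *)
Lemma free_embedding_free : ~ acl (fun y => (exists w, y = i w) \/ C y) (i' xi) ->
  free_embedding C e (j \o f0) i' (map j cs).
Proof.
case: hi => h1 h2 h3 hx; split.
- by move=> z /=; rewrite ij.
- by move=> _ /mapP [c hc ->]; rewrite ij; apply: h2.
move=> d u hd Cu hu; apply: acl_mono (h3 d u hd Cu _).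
  move=> y [|[[c hc ->]|]]; auto; right; left; exists (j c); rewrite ?ij //.
  exact: map_f.
have hu' : acl (fun y => ((exists w, y = i w) \/ y \in d) \/ y = i' xi) u.
  apply: acl_trans hu => y [[z ->]|hy]; last by apply: acl_base; auto.
  by apply: acl_mono (acl_gen (range_extension z)) => v [|]; auto.
apply: NNPP => hn; apply: hx; apply: acl_mono (acl_exchange hu' hn).
by move=> y [[|/hd]|->]; auto.
Qed.

End OneSide.

Lemma minimal_poly (K G : fieldType) (i : {rmorphism K -> G}) x :
  acl (fun y => exists w, y = i w) x ->
  exists p : {poly K}, [/\ p != 0, root (map_poly i p) x &
    forall q, root (map_poly i q) x -> q != 0 -> (size p <= size q)%N].
Proof.
case=> p [p0 [hp px]].
have rangeP y : gen_field (fun y => exists w, y = i w) y -> exists w, y = i w.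
  move=> h; have [|w _ ->] := @gen_morph_inv K G i (fun=> True) y; last by exists w.
  by apply: gen_mono h => z [w ->]; exists w.
have /choice [c hc] : forall k, exists w, p`_k = i w by move=> k; apply/rangeP/hp.
have [q qE] : exists q, map_poly i q = p.
  exists (\poly_(k < size p) c k); apply/polyP => k; rewrite coef_map /= coef_poly.
  case: ltnP => hk; first by rewrite hc.
  by rewrite rmorph0 nth_default.
have qx : root (map_poly i q) x by rewrite qE.
have q0 : q != 0 by rewrite -(map_poly_eq0 i) qE.
suff H m (r : {poly K}) : (size r < m)%N -> root (map_poly i r) x -> r != 0 ->
    exists p : {poly K}, [/\ p != 0, root (map_poly i p) x &
    forall q, root (map_poly i q) x -> q != 0 -> (size p <= size q)%N].
  exact: (H (size q).+1 q).
elim: m r => // m IH r hm rx r0.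
have [[s [sx s0 hs]]|hn] :=
    classic (exists s, [/\ root (map_poly i s) x, s != 0 & (size s < size r)%N]).
  by apply: (IH s) => //; apply: leq_trans hs _.
exists r; split=> // s sx s0; rewrite leqNgt; apply/negP => hs; apply: hn.
by exists s.
Qed.

Section BackAndForth.
Variables (F : fieldType) (delta : F -> F) (hd : derivation delta).

Section State.
Variables (G1 : fieldType) (C1 : G1 -> Prop) (e1 : {rmorphism F -> G1}).
Variables (G2 : fieldType) (C2 : G2 -> Prop) (e2 : {rmorphism F -> G2}).

(** The list [t] generates [K] over [F]. Its finiteness allows [good_free] and [good_free_const] to
    be applied to the image of [t], which yields elements free over all of [K]. *)
Definition state (K : fieldType) (f0 : F -> K) (i1 : {rmorphism K -> G1})
    (i2 : {rmorphism K -> G2}) (cs t : seq K) : Prop :=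
  [/\ free_embedding C1 e1 f0 i1 cs, free_embedding C2 e2 f0 i2 cs &
    forall z, gen_field (fun y => (exists w, y = f0 w) \/ y \in t) z].

Lemma state_init : exists f0 : F -> F, state f0 e1 e2 [::] [::].
Proof.
exists id; split.
- split=> // d u hd' Cu; apply: acl_mono => y [|]; auto.
- split=> // d u hd' Cu; apply: acl_mono => y [|]; auto.
by move=> z; apply: gf_base; left; exists z.
Qed.

Definition extends (K : fieldType) (f0 : F -> K) (i1 : {rmorphism K -> G1})
    (i2 : {rmorphism K -> G2}) (t : seq K) (x : G1) (y : G2) : Prop :=
  exists (K' : fieldType) (j : {rmorphism K -> K'}) (i1' : {rmorphism K' -> G1})
    (i2' : {rmorphism K' -> G2}) (xi : K') (cs' : seq K'),
  [/\ state (j \o f0) i1' i2' cs' (xi :: map j t), forall z, i1' (j z) = i1 z,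
     forall z, i2' (j z) = i2 z, i1' xi = x & i2' xi = y].

Lemma gen_step (K : fieldType) (f0 : F -> K) t (K' : fieldType)
    (j : {rmorphism K -> K'}) xi :
  (forall z, gen_field (fun y => (exists w, y = f0 w) \/ y \in t) z) ->
  (forall z, gen_field (fun u => (exists w, u = j w) \/ u = xi) z) ->
  forall z, gen_field (fun y => (exists w, y = (j \o f0) w) \/ y \in xi :: map j t) z.
Proof.
move=> h h' z; apply: gen_bind (h' z) => y [[w ->]|->]; last first.
  by apply: gf_base; right; rewrite inE eqxx.
apply: gen_mono (gen_morph j (h w)) => u [x [[v ->]|hx] ->]; first by left; exists v.
by right; rewrite inE map_f // orbT.
Qed.

Section Steps.
Variables (K : fieldType) (f0 : F -> K) (i1 : {rmorphism K -> G1}).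
Variables (i2 : {rmorphism K -> G2}) (cs t : seq K).
Hypothesis st : state f0 i1 i2 cs t.

Lemma not_alg_poly (G : fieldType) (i : {rmorphism K -> G}) x (q : {poly K}) :
  ~ acl (fun y => exists w, y = i w) x -> ((map_poly i q).[x] == 0) = (q == 0).
Proof.
move=> h; have [->|q0] := eqVneq q 0; first by rewrite rmorph0 horner0 eqxx.
apply/negP => qx; apply: h; exists (map_poly i q); rewrite map_poly_eq0; split=> //.
by split=> // k; rewrite coef_map; apply: gf_base; exists q`_k.
Qed.

(** Any root [y] of the image of the minimal polynomial [p] of [x] will do: [x] and [y] both
    annihilate exactly the multiples of [p]. *)
Lemma extends_alg x : (forall p : {poly G2}, (1 < size p)%N -> exists a, root p a) ->
  acl (fun y => exists w, y = i1 w) x -> exists y, extends f0 i1 i2 t x y.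
Proof.
move=> hroot hx; have [h1 h2 h3] := st.
have [p [p0 px hmin]] := minimal_poly hx.
have sp : (1 < size p)%N.
  rewrite ltnNge; apply/negP => /size1_polyC pE.
  move: px p0; rewrite pE map_polyC rootE hornerC /= fmorph_eq0 => /eqP ->.
  by rewrite polyC0 eqxx.
have [|y py] := hroot (map_poly i2 p); first by rewrite size_map_poly.
exists y.
have dv q : root (map_poly i1 q) x = (p %| q).
  apply/idP/idP => [qx|/dvdpP [r ->]]; last by rewrite rmorphM rootM px orbT.
  rewrite /dvdp; apply/negPn/negP => hr.
  have rx : root (map_poly i1 (q %% p)) x.
    move: qx; rewrite {1}(divp_eq q p) rmorphD rmorphM !rootE hornerD hornerM.
    by rewrite (rootP px) mulr0 add0r.
  have := hmin _ rx hr.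
  by rewrite leqNgt ltn_modp p0.
have irr : irreducible_poly p.
  split=> // g sg gp; have [h hE] := dvdpP _ _ gp.
  have gh0 : g * h != 0 by rewrite mulrC -hE.
  have g0 : g != 0 by apply: contraNneq gh0 => ->; rewrite mul0r.
  have h0 : h != 0 by apply: contraNneq gh0 => ->; rewrite mulr0.
  have := px; rewrite {1}hE rmorphM rootM => /orP [hx'|gx]; last first.
    by rewrite /eqp gp -dv.
  have := hmin _ hx' h0; rewrite hE size_mul // => hs.
  have sg0 : (0 < size g)%N by rewrite size_poly_gt0.
  case/eqP: sg; case: (size g) hs sg0 => // a.
  by rewrite addnS /= -[X in (_ <= X)%N]addn0 leq_add2l leqn0 => /eqP ->.
have ker q : ((map_poly i1 q).[x] == 0) = ((map_poly i2 q).[y] == 0).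
  rewrite -!rootE dv; apply/idP/idP => [/dvdpP [r ->]|qy].
    by rewrite rmorphM rootM py orbT.
  apply: contraLR qy => npq.
  (* Irreducibility makes [p] prime to any [q] it does not divide, and coprime polynomials keep
     having no common root in [G2]. *)
  have cop : coprimep p q.
    rewrite /coprimep; apply/negPn/negP => hs.
    have [_ /(_ (gcdp p q) hs (dvdp_gcdl _ _))] := irr.
    by rewrite /eqp => /andP [_ /dvdp_trans/(_ (dvdp_gcdr p q))]; apply/negP.
  by apply: (coprimep_root _ py); rewrite coprimep_map.
have [K' [j [i1' [i2' [xi [hj1 hj2 hx1 hy1 hgen]]]]]] := simple_extension ker.
exists K', j, i1', i2', xi, (map j cs); split=> //; split; last exact: gen_step.
- by apply: (free_embedding_alg h1 hj1 hgen); rewrite hx1.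
- apply: (free_embedding_alg h2 hj2 hgen); rewrite hy1.
  exists (map_poly i2 p); rewrite map_poly_eq0; split=> //; split=> // k.
  by rewrite coef_map; apply: gf_base; exists p`_k.
Qed.

Lemma extends_transcendental x y :
  ~ acl (fun y => exists w, y = i1 w) x -> ~ acl (fun y => exists w, y = i2 w) y ->
  exists (K' : fieldType) (j : {rmorphism K -> K'})
    (i1' : {rmorphism K' -> G1}) (i2' : {rmorphism K' -> G2}) (xi : K'),
  [/\ forall z, i1' (j z) = i1 z, forall z, i2' (j z) = i2 z, i1' xi = x, i2' xi = y
    & forall z, gen_field (fun u => (exists w, u = j w) \/ u = xi) z].
Proof. by move=> hx hy; apply: simple_extension => q; rewrite !not_alg_poly. Qed.

Lemma extends_const x y : C1 x -> C2 y ->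
  ~ acl (fun y => exists w, y = i1 w) x -> ~ acl (fun y => exists w, y = i2 w) y ->
  extends f0 i1 i2 t x y.
Proof.
move=> Cx Cy hx hy; have [h1 h2 h3] := st.
have [K' [j [i1' [i2' [xi [hj1 hj2 hx1 hy1 hgen]]]]]] := extends_transcendental hx hy.
exists K', j, i1', i2', xi, (xi :: map j cs); split=> //; split; last exact: gen_step.
- by apply: (free_embedding_const h1 hj1 hgen); rewrite hx1.
- by apply: (free_embedding_const h2 hj2 hgen); rewrite hy1.
Qed.

Lemma extends_free x y :
  ~ acl (fun y => (exists w, y = i1 w) \/ C1 y) x ->
  ~ acl (fun y => (exists w, y = i2 w) \/ C2 y) y ->
  extends f0 i1 i2 t x y.
Proof.
move=> hx hy; have [h1 h2 h3] := st.
have [||K' [j [i1' [i2' [xi [hj1 hj2 hx1 hy1 hgen]]]]]] := @extends_transcendental x y.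
- by move=> h; apply: hx; apply: acl_mono h; auto.
- by move=> h; apply: hy; apply: acl_mono h; auto.
exists K', j, i1', i2', xi, (map j cs); split=> //; split; last exact: gen_step.
- by apply: (free_embedding_free h1 hj1 hgen); rewrite hx1.
- by apply: (free_embedding_free h2 hj2 hgen); rewrite hy1.
Qed.

Lemma state_range2 z : gen_field (fun y => (exists w, y = e2 w) \/ y \in map i2 t) (i2 z).
Proof.
have [_ [h _ _] h3] := st.
apply: gen_mono (gen_morph i2 (h3 z)) => u [x [[v ->]|hx] ->]; first by left; exists v.
by right; apply: map_f.
Qed.

Lemma state_range1 z : gen_field (fun y => (exists w, y = e1 w) \/ y \in map i1 t) (i1 z).
Proof.
have [[h _ _] _ h3] := st.
apply: gen_mono (gen_morph i1 (h3 z)) => u [x [[v ->]|hx] ->]; first by left; exists v.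
by right; apply: map_f.
Qed.

(** A constant of [K] is algebraic over [F] and [cs] by freeness, then over [ker delta] and [cs] by
    descent. This last dependence lives in [K], so it passes to [G2], where [C2] is relatively
    algebraically closed. *)
Lemma state_const : good_pair delta C1 e1 -> good_pair delta C2 e2 ->
  forall z, C1 (i1 z) -> C2 (i2 z).
Proof.
move=> good1 good2 z Cz; have [[h1 hc1 hf1] [h2 hc2 hf2] _] := st.
have : acl (fun y => (exists z, y = e1 z) \/ ((exists2 c, c \in cs & y = i1 c) \/ y \in [::])) (i1 z).
  by apply: hf1 => //; apply: acl_base; left; exists z.
move/(acl_mono (B := fun y => (exists z, y = e1 z) \/ (exists2 c, c \in cs & y = i1 c))) => hz.
have {}hz := hz (fun y h => match h with or_introl a => or_introl a
  | or_intror (or_introl a) => or_intror a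
  | or_intror (or_intror a) => False_ind _ (notF a) end).
have DC y : (exists2 c, c \in cs & y = i1 c) -> C1 y by case=> c /hc1 ? ->.
have := const_descent hd good1 DC Cz hz.
pose B u := (exists2 w, delta w = 0 & u = f0 w) \/ u \in cs.
move/(acl_mono (B := fun y => exists2 x, B x & y = i1 x)) => /(_ _)/acl_morph H.
apply: (good_acl good2); have /(acl_morph i2) : acl B z.
  apply: H => y [[w hw ->]|[c hc ->]]; first by exists (f0 w); [left; exists w|].
  by exists c => //; right.
apply: acl_mono => y [u [[w hw ->]|hu] ->]; last exact: hc2.
by rewrite h2; apply/(good_const good2).
Qed.

End Steps.

Hypothesis good2 : good_pair delta C2 e2.

(** When [x] is algebraic over [K], nothing is demanded of its image here: that it is a constant
    follows from [state_const] for the new state. *)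
Lemma extends_const_any (K : fieldType) (f0 : F -> K) i1 i2 cs t x :
  @state K f0 i1 i2 cs t -> C1 x -> exists y, extends f0 i1 i2 t x y.
Proof.
move=> st Cx; have [hx|hx] := classic (acl (fun y => exists w, y = i1 w) x).
  exact: (extends_alg st (good_root good2) hx).
have [y Cy hy] := good_free_const good2 (map i2 t).
exists y; apply: (extends_const st Cx Cy hx) => h; apply: hy.
by apply: acl_trans h => _ [w ->]; apply/acl_gen/(state_range2 st).
Qed.

Definition extends_state (K : fieldType) (f0 : F -> K) (i1 : {rmorphism K -> G1})
    (i2 : {rmorphism K -> G2}) (x : G1) : Prop :=
  exists (K' : fieldType) (j : {rmorphism K -> K'}) (i1' : {rmorphism K' -> G1})
    (i2' : {rmorphism K' -> G2}) (xi : K') (cs' t' : seq K'),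
  [/\ state (j \o f0) i1' i2' cs' t', forall z, i1' (j z) = i1 z,
     forall z, i2' (j z) = i2 z & i1' xi = x].

Lemma extends_extends_state (K : fieldType) (f0 : F -> K) i1 i2 t x :
  (exists y, extends f0 i1 i2 t x y) -> extends_state f0 i1 i2 x.
Proof.
case=> y [K' [j [i1' [i2' [xi [cs' [h1 h2 h3 h4 _]]]]]]].
by exists K', j, i1', i2', xi, cs', (xi :: map j t).
Qed.

(** If [x] is algebraic over [K] and [C1], finitely many constants suffice: they are adjoined one by
    one, after which [x] is algebraic over the enlarged field. Otherwise [x] is matched with a free
    element of [G2]. *)
Lemma extends_any (K : fieldType) (f0 : F -> K) i1 i2 cs t x :
  @state K f0 i1 i2 cs t -> extends_state f0 i1 i2 x.
Proof.
move=> st; have [hx|hx] := classic (acl (fun y => (exists w, y = i1 w) \/ C1 y) x); last first.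
  have [y hy] := good_free good2 (map i2 t).
  apply: (@extends_extends_state _ _ _ _ t); exists y; apply: (extends_free st hx) => h; apply: hy.
  apply: acl_trans h => z [[w ->]|h]; last by apply: acl_base; right.
  by apply: acl_mono (acl_gen (state_range2 st w)); auto.
have [c [hc {}hx]] := acl_finite hx.
elim: c K f0 i1 i2 cs t st hc hx => [|c l IH] K f0 i1 i2 cs t st hc hx.
  apply: (@extends_extends_state _ _ _ _ t).
  apply: (extends_alg st (good_root good2)).
  by apply: acl_mono hx => y [|].
have [|y [K' [j [i1' [i2' [xi [cs' [st' h1 h2 h3 _]]]]]]]] := extends_const_any (x := c) st _.
  by apply: hc; rewrite inE eqxx.
have [||K'' [j' [i1'' [i2'' [xi' [cs'' [t'' [st'' g1 g2 g3]]]]]]]] := IH _ _ _ _ _ _ st'.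
- by move=> z hz; apply: hc; rewrite inE hz orbT.
- apply: acl_mono hx => z [[w ->]|].
    by left; exists (j w).
  rewrite inE => /orP [/eqP ->|]; auto; left; by exists xi.
exists K'', (j' \o j), i1'', i2'', xi', cs'', t''; split=> //.
- by move=> z /=; rewrite g1.
- by move=> z /=; rewrite g2.
Qed.

End State.

Lemma state_swap (G1 G2 : fieldType) (C1 : G1 -> Prop) (C2 : G2 -> Prop) e1 e2
  (K : fieldType) (f0 : F -> K) i1 i2 cs t :
  @state G1 C1 e1 G2 C2 e2 K f0 i1 i2 cs t -> @state G2 C2 e2 G1 C1 e1 K f0 i2 i1 cs t.
Proof. by case. Qed.

Lemma state_teval (G1 G2 : fieldType) (C1 : G1 -> Prop) (C2 : G2 -> Prop) e1 e2
  (K : fieldType) (f0 : F -> K) i1 i2 cs t (v : nat -> K) s :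
  @state G1 C1 e1 G2 C2 e2 K f0 i1 i2 cs t -> noDer s ->
  teval id e1 (fun k => i1 (v k)) s = i1 (teval id f0 v s).
Proof.
case=> [[h _ _] _ _]; elim: s => //= [||s IHs u IHu [/IHs -> /IHu ->]|s IHs /IHs ->
  |s IHs u IHu [/IHs -> /IHu ->]].
- by rewrite rmorph0.
- by rewrite rmorph1.
- by rewrite rmorphD.
- by rewrite rmorphN.
- by rewrite rmorphM.
Qed.

(** An implication is enough because the pairs are quantified after [f]: negation uses the induction
    hypothesis with the two sides exchanged. *)
Lemma state_sat f : pair_fml f ->
  forall (G1 : fieldType) (C1 : G1 -> Prop) (e1 : {rmorphism F -> G1})
    (G2 : fieldType) (C2 : G2 -> Prop) (e2 : {rmorphism F -> G2}),
  good_pair delta C1 e1 -> good_pair delta C2 e2 ->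
  forall (K : fieldType) (f0 : F -> K) i1 i2 cs t (v : nat -> K),
  @state G1 C1 e1 G2 C2 e2 K f0 i1 i2 cs t ->
  sat id C1 e1 (fun k => i1 (v k)) f -> sat id C2 e2 (fun k => i2 (v k)) f.
Proof.
elim: f => /= [s u [ns nu]|s ns|f IH hf|f IHf g IHg [hf hg]|k f IH hf]
  G1 C1 e1 G2 C2 e2 good1 good2 K f0 i1 i2 cs t v st.
- rewrite !(state_teval _ st) // !(state_teval _ (state_swap st)) //.
  by move/(fmorph_inj i1) ->.
- rewrite (state_teval _ st) // (state_teval _ (state_swap st)) //.
  exact: (state_const st).
- move=> h h'; apply: h.
  exact: (IH hf _ _ _ _ _ _ good2 good1 _ _ _ _ _ _ _ (state_swap st)).
- case=> h1 h2; split.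
    exact: (IHf hf _ _ _ _ _ _ good1 good2 _ _ _ _ _ _ _ st).
  exact: (IHg hg _ _ _ _ _ _ good1 good2 _ _ _ _ _ _ _ st).
- case=> x hx.
  have [K' [j [i1' [i2' [xi [cs' [t' [st' h1 h2 h3]]]]]]]] := extends_any good2 x st.
  pose v' := upd (fun k => j (v k)) k xi.
  have E1 : upd (fun k => i1 (v k)) k x = (fun k => i1' (v' k)).
    by apply: functional_extensionality => l; rewrite /v' /upd; case: ifP.
  have E2 : upd (fun k => i2 (v k)) k (i2' xi) = (fun k => i2' (v' k)).
    by apply: functional_extensionality => l; rewrite /v' /upd; case: ifP.
  exists (i2' xi); rewrite E2; apply: (IH hf _ _ _ _ _ _ good1 good2 _ _ _ _ _ _ _ st').
  by rewrite -E1.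
Qed.

End BackAndForth.

(** * Comparison of the dimensions *)

Section Points.
Variables (F : fieldType) (delta : F -> F) (hd : derivation delta).
Variables (G1 : fieldType) (C1 : G1 -> Prop) (e1 : {rmorphism F -> G1}).
Variables (G2 : fieldType) (C2 : G2 -> Prop) (e2 : {rmorphism F -> G2}).
Hypotheses (good1 : good_pair delta C1 e1) (good2 : good_pair delta C2 e2).

Lemma indep_not_acl (G : fieldType) (C : G -> Prop) (e : {rmorphism F -> G}) n
    (a : 'I_n -> G) (S : {set 'I_n}) (l : seq 'I_n) i (K : fieldType) (g : K -> G)
    (t : seq K) :
  indep (cl2 e C) a S -> i \in S -> i \notin l -> {subset l <= S} ->
  (forall z, gen_field (fun y => (exists w, y = e w) \/ y \in map g t) (g z)) ->
  (forall z, z \in t -> exists2 j, j \in l & g z = a j) ->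
  ~ acl (fun y => (exists w, y = g w) \/ C y) (a i).
Proof.
move=> ha iS il lS hgen ht h; apply: (ha i iS); apply: acl_trans h => y [[w ->]|hy].
  apply: acl_mono (acl_gen (hgen w)) => z [|/mapP [u /ht [j jl uE] ->]]; auto.
  by left; exists j; [exact: lS|split=> //; apply: contraNneq il => <-].
by apply: acl_base; auto.
Qed.

Lemma state_of_indep n (a : 'I_n -> G1) (b : 'I_n -> G2) (S : {set 'I_n}) l :
  indep (cl2 e1 C1) a S -> indep (cl2 e2 C2) b S -> uniq l -> {subset l <= S} ->
  exists (K : fieldType) (f0 : F -> K) (i1 : {rmorphism K -> G1})
    (i2 : {rmorphism K -> G2}) (cs t : seq K) (v : 'I_n -> K),
  [/\ state C1 e1 C2 e2 f0 i1 i2 cs t,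
    forall i, i \in l -> i1 (v i) = a i /\ i2 (v i) = b i
    & forall z, z \in t -> exists2 i, i \in l & z = v i].
Proof.
move=> ha hb; elim: l => [_ _|i l IH /= /andP [il ul] lS].
  have [f0 st] := state_init C1 e1 C2 e2.
  by exists F, f0, e1, e2, [::], [::], (fun=> 0).
have lS' : {subset l <= S} by move=> j jl; apply: lS; rewrite inE jl orbT.
have iS : i \in S by apply: lS; rewrite inE eqxx.
have [K [f0 [i1 [i2 [cs [t [v [st hv ht]]]]]]]] := IH ul lS'.
have [||K' [j [i1' [i2' [xi [cs' [st' h1 h2 h3 h4]]]]]]] :=
    @extends_free F G1 C1 e1 G2 C2 e2 K f0 i1 i2 cs t st (a i) (b i).
- apply: (indep_not_acl ha iS il lS' (state_range1 st)) => z /ht [k kl ->].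
  by exists k => //; case: (hv k kl).
- apply: (indep_not_acl hb iS il lS' (state_range2 st)) => z /ht [k kl ->].
  by exists k => //; case: (hv k kl).
exists K', (j \o f0), i1', i2', cs', (xi :: map j t), (fun k => if k == i then xi else j (v k)).
split=> //.
- move=> k; rewrite inE; case: eqP => [-> _ //|_ /= kl].
  by rewrite h1 h2; apply: hv.
- move=> z; rewrite inE => /orP [/eqP ->|/mapP [u /ht [k kl ->] ->]].
    by exists i; rewrite ?inE eqxx.
  by exists k; rewrite ?inE ?kl ?orbT //; case: eqP => // E; rewrite -E kl in il.
Qed.

(** The coordinates in [S] are free on both sides, so [a] and [b] can be matched there; the
    remaining coordinates of [a] are then added by [extends_any], and [b'] collects their images. *)
Lemma transfer_point n (a : 'I_n -> G1) (b : 'I_n -> G2) (S : {set 'I_n}) phi :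
  pair_fml phi -> indep (cl2 e1 C1) a S -> indep (cl2 e2 C2) b S ->
  defset id C1 e1 phi a ->
  exists2 b' : 'I_n -> G2, (forall i, i \in S -> b' i = b i) & defset id C2 e2 phi b'.
Proof.
move=> hphi ha hb hX.
have hS : {subset enum S <= S} by move=> i; rewrite mem_enum.
have [K0 [f00 [i10 [i20 [cs0 [t0 [v0 [st0 hv0 _]]]]]]]] :=
  state_of_indep ha hb (enum_uniq S) hS.
have [K [f0 [i1 [i2 [cs [t [v [st hv1 hv2]]]]]]]] : exists (K : fieldType) (f0 : F -> K)
    (i1 : {rmorphism K -> G1}) (i2 : {rmorphism K -> G2}) (cs t : seq K) (v : 'I_n -> K),
    [/\ state C1 e1 C2 e2 f0 i1 i2 cs t, forall i, i1 (v i) = a i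
      & forall i, i \in S -> i2 (v i) = b i].
  suff H (l : seq 'I_n) : {subset l <= ~: S} ->
      exists (K : fieldType) (f0 : F -> K) (i1 : {rmorphism K -> G1})
      (i2 : {rmorphism K -> G2}) (cs t : seq K) (v : 'I_n -> K),
      [/\ state C1 e1 C2 e2 f0 i1 i2 cs t, forall i, (i \in S) || (i \in l) -> i1 (v i) = a i
      & forall i, i \in S -> i2 (v i) = b i].
    have [|K [f0 [i1 [i2 [cs [t [v [st h1 h2]]]]]]]] := H (enum (~: S)).
      by move=> i; rewrite mem_enum.
    exists K, f0, i1, i2, cs, t, v; split=> // i; apply: h1.
    by rewrite mem_enum inE; case: (i \in S).
  elim: l => [_|i l IH lS].
    exists K0, f00, i10, i20, cs0, t0, v0; split=> // i.
      by rewrite orbF => iS; case: (hv0 i); rewrite ?mem_enum.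
    by move=> iS; case: (hv0 i); rewrite ?mem_enum.
  have [|K [f0 [i1 [i2 [cs [t [v [st h1 h2]]]]]]]] := IH.
    by move=> k kl; apply: lS; rewrite inE kl orbT.
  have iS : i \notin S by have := lS i (mem_head _ _); rewrite inE.
  have [K' [j [i1' [i2' [xi [cs' [t' [st' g1 g2 g3]]]]]]]] := extends_any good2 (a i) st.
  exists K', (j \o f0), i1', i2', cs', t', (fun k => if k == i then xi else j (v k)).
  split=> // k; first by rewrite inE; case: eqP => [-> //|_ /= hk]; rewrite g1 h1.
  by case: eqP => [->|_ kS]; [rewrite (negbTE iS)|rewrite g2 h2].
exists (fun i => i2 (v i)) => //.
have tvalE (G : fieldType) (i : {rmorphism K -> G}) :
    Defs.tval (fun k => i (v k)) = (fun k => i (Defs.tval v k)).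
  apply: functional_extensionality => k; rewrite /Defs.tval.
  by case: insubP => [? ? ?|_] //; rewrite rmorph0.
rewrite /defset tvalE; apply: (state_sat hd hphi good1 good2 st).
rewrite -tvalE; move: hX; rewrite /defset (_ : a = fun k => i1 (v k)) //.
by apply: functional_extensionality => k.
Qed.

End Points.

(** Every independent set of coordinates is bounded in size by a largest one, so the rank of each
    point can be eliminated. For empty [X], note that [set0] is independent for any point. *)
Lemma is_dim_alt (R : Type) n (X : ('I_n -> R) -> Prop) cl D :
  is_dim X (cl_dim cl) D <->
  match D with
  | None => forall S, ~ exists2 a, X a & indep cl a S
  | Some k => (exists2 S : {set 'I_n}, #|S| = k & exists2 a, X a & indep cl a S) /\
              (forall S : {set 'I_n}, (exists2 a, X a & indep cl a S) -> (#|S| <= k)%N)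
  end.
Proof.
case: D => [k|] /=; last first.
  split=> [h S [a /h] //|h a Xa]; apply: (h set0); exists a => //.
  by move=> i; rewrite inE.
split=> [[[a [Xa [S [hS cS hmax]]]] hb]|[[S cS [a Xa hS]] hb]].
  split; first by exists S => //; exists a.
  move=> T [a' Xa' hT].
  have hT' : asb (indep cl a' T) by apply/asbP.
  case: (@arg_maxnP _ T (fun T => asb (indep cl a' T)) (fun T => #|T|) hT') => U /asbP hU hUm.
  apply: leq_trans (hUm T hT') _; apply: (hb a') => //.
  by exists U; split=> // V hV; apply: hUm; apply/asbP.
split.
  by exists a; split=> //; exists S; split=> // T hT; apply: hb; exists a.
by move=> a' k' Xa' [T [hT <- _]]; apply: hb; exists a'.
Qed.

Lemma is_dim_iff (R R' : Type) n (X : ('I_n -> R) -> Prop) (X' : ('I_n -> R') -> Prop) cl cl' D :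
  (forall S, (exists2 a, X a & indep cl a S) <-> (exists2 a, X' a & indep cl' a S)) ->
  is_dim X (cl_dim cl) D <-> is_dim X' (cl_dim cl') D.
Proof.
move=> h; rewrite !is_dim_alt; case: D => [k|]; last by split=> H S /h /H.
split=> -[[S cS /h hS] H]; (split; first by exists S) => T /h; exact: H.
Qed.

Lemma indep_tuple_exists (F G : fieldType) (delta : F -> F) (C : G -> Prop)
    (e : {rmorphism F -> G}) n : good_pair delta C e ->
  exists a : 'I_n -> G, forall S, indep (cl2 e C) a S.
Proof.
move=> good; pose B y := (exists z, y = e z) \/ C y.
have [s ss hs] : exists2 s, size s = n & forall i, (i < n)%N ->
    ~ acl (fun y => B y \/ exists j, [/\ (j < n)%N, j != i & y = nth 0 s j]) (nth 0 s i).
  elim: n => [|m [s ss IH]]; first by exists [::].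
  have [x hx] := good_free good s.
  have hx' : ~ acl (fun y => B y \/ exists j, (j < m)%N /\ y = nth 0 s j) x.
    move=> h; apply: hx; apply: acl_mono h => y [[|]|[j [hj ->]]]; auto.
    by left; right; rewrite mem_nth ?ss.
  exists (rcons s x); first by rewrite size_rcons ss.
  move=> i; rewrite ltnS leq_eqVlt => /orP [/eqP ->|im].
    rewrite nth_rcons ss ltnn eqxx => h; apply: hx'; apply: acl_mono h => y [|[j [hj jm ->]]]; auto.
    have {}hj : (j < m)%N by rewrite ltn_neqAle jm -ltnS.
    by right; exists j; rewrite nth_rcons ss hj.
  rewrite nth_rcons ss im => h; apply: hx'.
  (* If an old entry depended on the others and on [x], exchange would make [x] algebraic over the
     old entries. *)
  have h' : acl (fun y => (B y \/ exists j, [/\ (j < m)%N, j != i & y = nth 0 s j]) \/ y = x) (nth 0 s i).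
    apply: acl_mono h => y [|[j [hj ji ->]]]; auto; rewrite nth_rcons ss.
    have [hjm|hjm] := ltnP j m; first by left; right; exists j.
    have /eqP -> : j == m by rewrite eqn_leq hjm -ltnS hj.
    by rewrite eqxx; right.
  apply: acl_mono (acl_exchange h' (IH i im)) => y [[|[j [hj _ ->]]]|->]; auto.
    by right; exists j.
  by right; exists i.
exists (fun i => nth 0 s i) => S i iS h; apply: (hs i (ltn_ord i)).
apply: acl_mono h => y [[j jS [ji ->]]|[|]]; rewrite /B; auto.
by right; exists j.
Qed.

Lemma elem_ext_rmorphism (L : forall P, fml P -> Prop) (F G : fieldType) d c d' c' (e : F -> G) :
  (forall t u : term F, noDer t -> noDer u -> L F (FEq t u)) ->
  elem_ext L d c d' c' e -> exists g : {rmorphism F -> G}, (g : F -> G) = e.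
Proof.
move=> hL he; apply: mk_rmorphism.
- move=> x y; have := (he (FEq (TAdd (TPar x) (TPar y)) (TPar (x + y))) (fun=> 0) (hL _ _ _ _)).1.
  by move=> /= -> //.
- have := (he (FEq TOne (TPar 1)) (fun=> 0) (hL _ _ _ _)).1.
  by move=> /= <- //.
- move=> x y; have := (he (FEq (TMul (TPar x) (TPar y)) (TPar (x * y))) (fun=> 0) (hL _ _ _ _)).1.
  by move=> /= -> //.
Qed.

Lemma elem_ext_derivation (F G : fieldType) (d : F -> F) (d' : G -> G) (e : F -> G) :
  derivation d -> elem_ext diff_fml d (fun=> False) d' (fun=> False) e -> derivation d'.
Proof.
move=> hd he.
have LN : forall P (f : fml P), diff_fml f -> diff_fml (FNot f) by [].
have LE : forall P i (f : fml P), diff_fml f -> diff_fml (FEx i f) by [].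
pose x := TVar F 0; pose y := TVar F 1.
split=> a b.
  have /(transfer_all LN LE he) [H _] : diff_fml (FEq (TDer (TAdd x y)) (TAdd (TDer x) (TDer y))) by [].
  have := H _ (fun k => if k == 0%N then a else b); apply=> w /=; exact: der_add.
have /(transfer_all LN LE he) [H _] :
    diff_fml (FEq (TDer (TMul x y)) (TAdd (TMul (TDer x) y) (TMul x (TDer y)))) by [].
have := H _ (fun k => if k == 0%N then a else b); apply=> w /=; exact: der_mul.
Qed.

Lemma dcl_indep_tuple_exists (F : fieldType) (delta : F -> F) (F2 : fieldType)
    (delta2 : F2 -> F2) (e2 : {rmorphism F -> F2}) n :
  diff_closed delta -> [pchar F] =i pred0 ->
  elem_ext diff_fml delta (fun=> False) delta2 (fun=> False) e2 ->
  saturated_over diff_fml F delta2 (fun=> False) ->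
  exists b : 'I_n -> F2, forall S, indep (dcl e2 delta2) b S.
Proof.
move=> hdc ch he hs.
(* Asking for [n.+1] coordinates keeps the modulus of the variable encoding positive, even when [n]
   is 0. *)
have [b sb gb] := generic_exists hdc ch he hs (n := n.+1) (leqnSn n).
exists (fun i => nth 0 b i) => S i iS.
apply: (generic_not_dcl ch he (ltn0Sn n) gb (leqnSn n) (ltn_ord i)) => y [j jS [ji ->]].
by exists j.
Qed.

Lemma dcl_indep_cl2 (F F2 : fieldType) (delta2 : F2 -> F2) (e2 : F -> F2) n
    (b : 'I_n -> F2) S : derivation delta2 -> [pchar F2] =i pred0 ->
  indep (dcl e2 delta2) b S -> indep (cl2 e2 (fun x => delta2 x = 0)) b S.
Proof. by move=> hd ch h i iS hi; apply: (h i iS); apply: acl_consts_dcl. Qed.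

Lemma indep_eq (R : Type) cl n (a b : 'I_n -> R) (S : {set 'I_n}) :
  (forall A B x, (forall y, A y -> B y) -> cl A x -> cl B x) ->
  (forall i, i \in S -> a i = b i) -> indep cl a S -> indep cl b S.
Proof.
move=> mono ab h i iS; rewrite -ab // => hi; apply: (h i iS).
by apply: mono hi => y [j jS [ji ->]]; exists j => //; rewrite ab.
Qed.

Lemma cl2_mono (F G : fieldType) (e : F -> G) C (A B : G -> Prop) x :
  (forall y, A y -> B y) -> cl2 e C A x -> cl2 e C B x.
Proof. by move=> h; apply: acl_mono => y [/h|]; auto. Qed.

Lemma dcl_mono (F G : fieldType) (e : F -> G) d (A B : G -> Prop) x :
  (forall y, A y -> B y) -> dcl e d A x -> dcl e d B x.
Proof.
move=> h [k hk]; exists k; apply: acl_mono hk => y [[w [j [hw ->]]]|]; auto.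
by left; exists w, j; split=> //; case: hw => [/h|]; auto.
Qed.

Theorem theorem5p1
  (F : fieldType) (delta : F -> F)
  (hder : derivation delta) (hchar : [pchar F] =i pred0)
  (hdc : diff_closed delta)
  (n : nat) (phi : fml F) (hphi : pair_fml phi)
  (* M^sat = <F1, C1>, an |F|^+-saturated elementary extension of M = <F, ker delta> *)
  (F1 : fieldType) (C1 : F1 -> Prop) (e1 : F -> F1)
  (he1 : elem_ext pair_fml id (fun x => delta x = 0) id C1 e1)
  (hs1 : saturated_over pair_fml F id C1)
  (* K^sat = <F2, delta2>, an |F|^+-saturated elementary extension of K = <F, delta> *)
  (F2 : fieldType) (delta2 : F2 -> F2) (e2 : F -> F2)
  (he2 : elem_ext diff_fml delta (fun _ => False) delta2 (fun _ => False) e2)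
  (hs2 : saturated_over diff_fml F delta2 (fun _ => False))
  (D : option nat) :
  is_dim (n := n) (defset id C1 e1 phi) (cl_dim (cl2 e1 C1)) D <->
  is_dim (n := n) (defset delta2 (fun _ => False) e2 (to_diff phi)) (cl_dim (dcl e2 delta2)) D.
Proof.
have [g1 g1E] : exists g : {rmorphism F -> F1}, (g : F -> F1) = e1.
  by apply: elem_ext_rmorphism he1.
have [g2 g2E] : exists g : {rmorphism F -> F2}, (g : F -> F2) = e2.
  by apply: elem_ext_rmorphism he2.
subst e1 e2.
have hd2 := elem_ext_derivation hder he2.
have ch2 : [pchar F2] =i pred0 by move=> p; rewrite (fmorph_pchar g2).
have he2' := elem_ext_pair he2.
pose C2 x := delta2 x = 0.
(* One differentially transcendental element of [F2] serves as [x0] for both pairs, with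
   [<F2, ker delta2>] as the auxiliary extension. *)
have [b1 hb1] := dcl_indep_tuple_exists 1 hdc hchar he2 hs2.
have hx0 : ~ acl (fun y => (exists z, y = g2 z) \/ C2 y) (b1 ord0).
  have := dcl_indep_cl2 hd2 ch2 (hb1 [set ord0]) => /(_ ord0).
  rewrite inE eqxx => /(_ isT) h h'; apply: h.
  by apply: acl_mono h' => y; right.
have good1 := pair_good hder hchar hdc he1 hs1 he2' hx0.
have good2 := pair_good hder hchar hdc he2' (saturated_pair hs2) he2' hx0.
have defE (a : 'I_n -> F2) : defset id C2 g2 phi a <->
    defset delta2 (fun _ => False) g2 (to_diff phi) a by apply: sat_to_diff.
apply: is_dim_iff => S; split=> -[a Xa ha].
  (* The target tuple is chosen differentially independent. The transferred point agrees with it on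
     [S], and so is differentially independent there, though the transfer itself only uses
     independence in the sense of [cl2]. *)
  have [b hb] := dcl_indep_tuple_exists n hdc hchar he2 hs2.
  have hb' := dcl_indep_cl2 hd2 ch2 (hb S).
  have [b' bb' Xb'] := transfer_point hder good1 good2 hphi ha hb' Xa.
  exists b'; first exact/defE.
  by apply: indep_eq (hb S) => [A B x|i iS]; [exact: dcl_mono|rewrite bb'].
have [b hb] := indep_tuple_exists n good1.
have ha' := dcl_indep_cl2 hd2 ch2 ha.
have [b' bb' Xb'] := transfer_point hder good2 good1 hphi ha' (hb S) ((defE a).2 Xa).
exists b' => //.
by apply: indep_eq (hb S) => [A B x|i iS]; [exact: cl2_mono|rewrite bb'].
Qed.
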